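(* For any $\varepsilon>0$, if $\lambda=0.9\gamma^{-1}$ and $\eta=\varepsilon^2\lambda(1-\gamma\lambda)/(32\beta_{\mathcal X}^2)$, then the primal-dual smoothing framework (Algorithm 1 in the context, with its subproblems solved by the dual inexact accelerated proximal gradient (APG) method in the context) finds an $\varepsilon$-near-stationary point of $\min_{x\in\mathbb X}q(x)$ with primal gradient complexity $$T_{\mathrm p}(\varepsilon)=O\left(\sqrt{\gamma L_{xx}}\,\big(\sqrt{L_{yy}\gamma}+L_{xy}\big)\,\varepsilon^{-3}\,(\ln(\varepsilon^{-1}))^2\right)$$ and dual gradient complexity $$T_{\mathrm d}(\varepsilon)=O\left(\gamma\,\big(\sqrt{L_{yy}\gamma}+L_{xy}\big)\,\varepsilon^{-3}\ln(\varepsilon^{-1})\right).$$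
   Context: Problem. $\mathbb X,\mathbb Y$ are finite-dimensional real normed spaces (norms $\|\cdot\|$, dual norms $\|\cdot\|_*$). $r:\mathbb X\to\mathbb R\cup\{+\infty\}$ is closed and convex with $\mathcal X:=\operatorname{dom} r$ nonempty, closed, convex. $\mathcal Y\subseteq\mathbb Y$ is nonempty, convex and compact; $g:\mathcal Y\to\mathbb R$ is convex and continuous. $\mathcal X'\supseteq\mathcal X$, $\mathcal Y'\supseteq\mathcal Y$ are open; $\Phi:\mathcal X'\times\mathcal Y'\to\mathbb R$ is jointly continuous and $\Phi(x,\cdot)$ is concave on $\mathcal Y$ for each $x\in\mathcal X$. Let $f(x):=\max_{y\in\mathcal Y}\Phi(x,y)-g(y)$, $q:=f+r$ (equal to $+\infty$ off $\mathcal X$), $q^*:=\min_{x\in\mathbb X}q(x)$, assumed $>-\infty$. Assumptions: (1) for $y\in\mathcal Y$, $\Phi(\cdot,y)$ is differentiable on $\mathcal X'$ and for $x,x'\in\mathcal X$, $y,y'\in\mathcal Y$: $\|\nabla_x\Phi(x,y)-\nabla_x\Phi(x',y)\|_*\le L_{xx}\|x-x'\|$, $\|\nabla_x\Phi(x,y)-\nabla_x\Phi(x,y')\|_*\le L_{xy}\|y-y'\|$. (2) For some $\gamma\in(0,L_{xx}]$, for all $y\in\mathcal Y$, $x,x'\in\mathcal X$: $\Phi(x',y)-\Phi(x,y)-\langle\nabla_x\Phi(x,y),x'-x\rangle\ge-(\gamma/2)\|x'-x\|^2$. (3) For $x\in\mathcal X$, $\Phi(x,\cdot)$ is differentiable on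 $\mathcal Y'$ and for $x,x'\in\mathcal X$, $y,y'\in\mathcal Y$: $\|\nabla_y\Phi(x,y)-\nabla_y\Phi(x',y)\|_*\le L_{xy}\|x-x'\|$, $\|\nabla_y\Phi(x,y)-\nabla_y\Phi(x,y')\|_*\le L_{yy}\|y-y'\|$. Distance generating functions (DGF). For a nonempty closed convex set $\mathcal U$ in a finite-dimensional normed space $\mathbb U$, $\omega_{\mathcal U}:\mathbb U\to\mathbb R\cup\{+\infty\}$ is a DGF on $\mathcal U$ if it is continuous and 1-strongly convex on $\mathcal U$ and essentially smooth (continuously differentiable on $\operatorname{int}\operatorname{dom}\omega_{\mathcal U}$, with $\|\nabla\omega_{\mathcal U}(u_k)\|_*\to+\infty$ whenever $u_k\in\operatorname{int}\operatorname{dom}\omega_{\mathcal U}$ converges to a boundary point of $\operatorname{dom}\omega_{\mathcal U}$). $\mathcal U^o:=\mathcal U\cap\operatorname{int}\operatorname{dom}\omega_{\mathcal U}$, $D_{\omega_{\mathcal U}}(u',u):=\omega_{\mathcal U}(u')-\omega_{\mathcal U}(u)-\langle\nabla\omega_{\mathcal U}(u),u'-u\rangle$. $\omega_{\mathcal X}$ is a DGF on $\mathcal X$ that is twice continuously differentiable on $\operatorname{int}\operatorname{dom}\omega_{\mathcal X}$, with $\mathcal X\subseteq\operatorname{int}\operatorname{dom}\omega_{\mathcal X}$ and $\nabla\omega_{\mathcal X}$ $\beta_{\mathcal X}$-Lipschitz on $\mathcal X$, $\beta_{\mathcal X}\in[1,\infty)$. $\omega_{\mathcal Y}$ is a DGF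 on $\mathcal Y$, and $R_{\mathcal Y}(\omega_{\mathcal Y}):=\sup_{y\in\mathcal Y}|\omega_{\mathcal Y}(y)|<\infty$ (positive). The Bregman proximal problems $\min_{u\in\mathcal U}\varphi(u)+\langle\xi,u\rangle+\alpha^{-1}\omega_{\mathcal U}(u)$, $\alpha>0$, for $(\mathcal U,\varphi)=(\mathcal X,r)$ and $(\mathcal Y,g)$, are assumed to have unique, easily computable solutions in $\mathcal U^o$. Smoothing. For $\rho>0$: $f_\rho(x):=\max_{y\in\mathcal Y}\Phi(x,y)-g(y)-\rho\,\omega_{\mathcal Y}(y)$ and $q_\rho:=f_\rho+r$. For $0<\lambda<\gamma^{-1}$, $x\in\mathcal X$: $\operatorname{prox}(q,x,\lambda):=\arg\min_{x'\in\mathbb X}q(x')+\lambda^{-1}D_{\omega_{\mathcal X}}(x',x)$, $Q_\rho^\lambda(x';x):=q_\rho(x')+\lambda^{-1}D_{\omega_{\mathcal X}}(x',x)$, $q_\rho^\lambda(x):=\min_{x'\in\mathbb X}Q_\rho^\lambda(x';x)$. A point $x\in\mathcal X$ is $\varepsilon$-near-stationary if for some $0<\lambda<\gamma^{-1}$, $\|\lambda^{-1}(x-\operatorname{prox}(q,x,\lambda))\|\le\varepsilon/\beta_{\mathcal X}$. Algorithm 1. Input: $\eta>0$, $\lambda\in(0,\gamma^{-1})$, $\rho:=2\eta/R_{\mathcal Y}(\omega_{\mathcal Y})$, $x_1\in\mathcal X$. For $k=1,2,\ldots$: find $x_{k+1}\in\mathcal X$ with $Q_\rho^\lambda(x_{k+1};x_k)\le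 q_\rho^\lambda(x_k)+\eta$; terminate at the first $k$ for which $\|x_{k+1}-x_k\|\le\sqrt{2\eta/(\lambda^{-1}-\gamma)}$; output $x_K$ with $K$ this $k$. Algorithm 2 (APG) for $\min_{u\in\mathcal U}h(u)+\zeta(u)+\mu\omega_{\mathcal U}(u)$, $\mu>0$, with parameter $\bar L$: $\theta:=\mu/\bar L$, $\alpha_0=1$, $\alpha_t=(1+\sqrt\theta)^{t-1}\sqrt\theta$ ($t\ge1$), $A_t=\sum_{i\le t}\alpha_i$, $\tau_t=\alpha_t/A_t$; $u_0\in\mathcal U^o$, $s_0=\hat\nabla h(u_0)$, $z_0=\arg\min_{u\in\mathcal U}\langle s_0,u\rangle+\zeta(u)+\mu\omega_{\mathcal U}(u)+\bar LD_{\omega_{\mathcal U}}(u,u_0)$; for $t\ge0$: $\bar u_{t+1}=\arg\min_{u\in\mathcal U}\langle s_t,u\rangle+A_t(\zeta(u)+\mu\omega_{\mathcal U}(u))+\bar LD_{\omega_{\mathcal U}}(u,u_0)$; $u_{t+1}=(1-\tau_{t+1})z_t+\tau_{t+1}\bar u_{t+1}$; compute an approximate gradient $\hat\nabla h(u_{t+1})$; $s_{t+1}=s_t+\alpha_{t+1}\hat\nabla h(u_{t+1})$; $w_{t+1}=\arg\min_{u\in\mathcal U}\alpha_{t+1}(\langle\hat\nabla h(u_{t+1}),u\rangle+\zeta(u)+\mu\omega_{\mathcal U}(u))+(A_t\mu+\bar L)D_{\omega_{\mathcal U}}(u,\bar u_{t+1})$; $z_{t+1}=(1-\tau_{t+1})z_t+\tau_{t+1}w_{t+1}$.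 Dual inexact APG for the subproblem at $x_k$. The subproblem is the saddle-point problem $\min_{x\in\mathcal X}\max_{y\in\mathcal Y}\mu\omega_{\mathcal X}(x)+r(x)+\Psi(x,y)-g(y)-\rho\omega_{\mathcal Y}(y)$ (up to constants), with $\mu=\lambda^{-1}-\gamma$, $\Psi(x,y)=\gamma\omega_{\mathcal X}(x)-\lambda^{-1}\langle\nabla\omega_{\mathcal X}(x_k),x\rangle+\Phi(x,y)$, and $L'_{xx}=L_{xx}+\gamma\beta_{\mathcal X}$. Let $\psi^{\mathrm P}(x,y)=\Psi(x,y)+r(x)+\mu\omega_{\mathcal X}(x)$, $\pi(y)=\min_{x\in\mathcal X}\psi^{\mathrm P}(x,y)$, $L_\pi=L_{yy}+L_{xy}^2/\mu$. Apply Algorithm 2 to $\min_{y\in\mathcal Y}-\pi(y)+g(y)+\rho\omega_{\mathcal Y}(y)$ with $h=-\pi$, $\zeta=g$, strong convexity parameter $\rho$, $\bar L=2L_\pi$, and approximate gradient $-\nabla_y\Psi(\hat x(y_t),y_t)$, where $y_t$ is the $t$-th query point and $\hat x(y_t)\in\mathcal X$ satisfies $\psi^{\mathrm P}(\hat x(y_t),y_t)-\pi(y_t)\le\bar\epsilon/2$, $\bar\epsilon=\eta/(2(1+\sqrt{2L_\pi/\rho}))$. Each $\hat x(y_t)$ is computed by Algorithm 2 applied to $\min_{x\in\mathcal X}\psi^{\mathrm P}(x,y_t)$ with $h=\Psi(\cdot,y_t)$, $\zeta=r$, $\bar L=L'_{xx}$ and exact gradients. The returned $x_{k+1}$ is $\bar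 x_t=A_t^{-1}\sum_{i\le t}\alpha_i\hat x(y_i)$, for $t$ large enough that the duality gap of the saddle-point problem is at most $\eta$. Complexity. The primal (dual) gradient complexity is the total number of evaluations of $\nabla_x\Phi$ (of $\nabla_y\Phi$). In the $O(\cdot)$ bounds, the displayed dependence is on $L_{xx},L_{xy},L_{yy},\gamma$ and (small) $\varepsilon$; the factors $q(x_1)-q^*$, $\beta_{\mathcal X}$, $R_{\mathcal Y}(\omega_{\mathcal Y})$, the Bregman distances from the solvers' starting points, and problem constants inside the logarithms are suppressed. *)

(* Defs.v *)
From HB Require Import structures.
From mathcomp Require Import all_boot all_order all_algebra.
From mathcomp Require Import all_classical all_reals all_analysis.

Set Implicit Arguments.
Unset Strict Implicit.
Unset Printing Implicit Defensive.

Import Order.TTheory GRing.Theory Num.Theory.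
Import numFieldNormedType.Exports.

Local Open Scope classical_set_scope.
Local Open Scope ring_scope.

Definition finite_dimensional (R : realType) (V : normedModType R) : Prop :=
  exists (n : nat) (e : 'I_n -> V),
    forall v, exists c : 'I_n -> R, v = \sum_i c i *: e i.

(* Elements of the dual space are linear maps V -> R; gradients are the
   Frechet differentials 'd f x. *)
Definition dual_norm (R : realType) (V : normedModType R) (l : V -> R) : R :=
  sup [set l v | v in [set v : V | `|v| <= 1]].

Definition argmin_on (R : realType) (V : Type) (U : set V) (F : V -> \bar R)
    (u : V) : Prop :=
  U u /\ forall v, U v -> (F u <= F v)%E.

Definition edom (R : realType) (V : Type) (f : V -> \bar R) : set V :=
  [set u | (f u < +oo)%E].

Definition econvex (R : realType) (V : normedModType R) (f : V -> \bar R)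
  : Prop :=
  forall (u v : V) (s : R), 0 <= s <= 1 ->
    (f (s *: u + (1 - s) *: v)%R <= s%:E * f u + (1 - s)%:E * f v)%E.

Definition strongly_convex_on (R : realType) (V : normedModType R) (m : R)
    (U : set V) (f : V -> \bar R) : Prop :=
  forall (u v : V) (s : R), U u -> U v -> 0 <= s <= 1 ->
    (f (s *: u + (1 - s) *: v)%R + (m / 2 * s * (1 - s) * `|u - v| ^+ 2)%:E
       <= s%:E * f u + (1 - s)%:E * f v)%E.

(* D is meant to be open. *)
Definition C1_on (R : realType) (V : normedModType R) (D : set V) (f : V -> R)
  : Prop :=
  (forall u, D u -> differentiable f u) /\
  (forall u, D u -> dual_norm ('d f v \- 'd f u) @[v --> u] --> (0 : R)).

(* The dual of a finite-dimensional space is finite-dimensional, so the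
   dual-valued map u |-> 'd f u is C^1 iff each evaluation u |-> 'd f u v is. *)
Definition C2_on (R : realType) (V : normedModType R) (D : set V) (f : V -> R)
  : Prop :=
  C1_on D f /\ forall v : V, C1_on D (fun u => 'd f u v).

Record DGF (R : realType) (V : normedModType R) (U : set V)
    (om : V -> \bar R) : Prop := {
  dgf_proper : forall u, om u <> -oo%E;
  dgf_continuous : {within U, continuous om};
  dgf_strongly_convex : strongly_convex_on 1 U om;
  dgf_C1 : C1_on (interior (edom om)) (fine \o om);
  dgf_steep : forall (u_ : nat -> V) (b : V),
    (forall k, interior (edom om) (u_ k)) ->
    u_ @ \oo --> b ->
    (closure (edom om) `\` interior (edom om)) b ->
    dual_norm ('d (fine \o om) (u_ k)) @[k --> \oo] --> +oo }.

(* The set U^o. *)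
Definition dgf_interior (R : realType) (V : normedModType R) (U : set V)
    (om : V -> \bar R) : set V :=
  U `&` interior (edom om).

(* The Bregman divergence D_om(u', u), for u in the interior of the domain. *)
Definition bregman (R : realType) (V : normedModType R) (om : V -> \bar R)
    (u' u : V) : \bar R :=
  (om u' - om u - ('d (fine \o om) u (u' - u)%R)%:E)%E.

Definition bregman_prox_solvable (R : realType) (V : normedModType R)
    (U : set V) (phi om : V -> \bar R) : Prop :=
  forall (xi : {linear V -> R}) (a : R), 0 < a ->
    exists2 u, dgf_interior U om u &
      forall v, argmin_on U (fun w => phi w + (xi w)%:E + a^-1%:E * om w)%E v
                <-> v = u.

Definition first_index (Q : nat -> Prop) (n : nat) : Prop :=
  Q n /\ forall m, (m < n)%N -> ~ Q m.

Section APG.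
Context {R : realType} {V : normedModType R}.

Definition apg_alpha (theta : R) (t : nat) : R :=
  if t is t'.+1 then (1 + Num.sqrt theta) ^+ t' * Num.sqrt theta else 1.

Definition apg_A (theta : R) (t : nat) : R :=
  \sum_(0 <= i < t.+1) apg_alpha theta i.

Definition apg_tau (theta : R) (t : nat) : R :=
  apg_alpha theta t / apg_A theta t.

Fixpoint apg_s (theta : R) (G : nat -> V -> R) (t : nat) : V -> R :=
  if t is t'.+1 then
    fun v => apg_s theta G t' v + apg_alpha theta t * G t v
  else G 0%N.

(* apg_ubar and apg_w are used from index 1 on. *)
Record apg_trace (W : Type) := ApgTrace {
  apg_u : nat -> W;
  apg_z : nat -> W;
  apg_ubar : nat -> W;
  apg_w : nat -> W }.

(* The first n iterations of the accelerated proximal gradient method for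
   min_U h + zeta + mu om, where G t is the approximate gradient of h at the
   query point apg_u tr t.  The point apg_z tr n is obtained after n.+1
   gradient evaluations. *)
Definition is_apg (U : set V) (om zeta : V -> \bar R) (mu L : R)
    (G : nat -> V -> R) (n : nat) (tr : apg_trace V) : Prop :=
  let theta := mu / L in
  let alpha := apg_alpha theta in
  let A := apg_A theta in
  let tau := apg_tau theta in
  let s := apg_s theta G in
  [/\ dgf_interior U om (apg_u tr 0),
      argmin_on U (fun v => (s 0%N v)%:E + zeta v + mu%:E * om v
                            + L%:E * bregman om v (apg_u tr 0))%E
        (apg_z tr 0) &
      forall t, (t < n)%N ->
      [/\ argmin_on U (fun v => (s t v)%:E + (A t)%:E * (zeta v + mu%:E * om v)
                                + L%:E * bregman om v (apg_u tr 0))%E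
            (apg_ubar tr t.+1),
          apg_u tr t.+1 = (1 - tau t.+1) *: apg_z tr t
                          + tau t.+1 *: apg_ubar tr t.+1,
          argmin_on U (fun v => (alpha t.+1)%:E *
                                  ((G t.+1 v)%:E + zeta v + mu%:E * om v)
                                + (A t * mu + L)%:E
                                  * bregman om v (apg_ubar tr t.+1))%E
            (apg_w tr t.+1) &
          apg_z tr t.+1 = (1 - tau t.+1) *: apg_z tr t
                          + tau t.+1 *: apg_w tr t.+1 ] ].

End APG.

Record constants (R : realType) := Constants {
  Lxx : R; Lxy : R; Lyy : R; gamma : R; betaX : R }.

(* min_x max_y Phi(x, y) - g(y) + r(x).  The partial function
   Phi : X' x Y' -> R is represented by a total one. *)
Record problem (R : realType) (X Y : normedModType R) := Problem {
  cst :> constants R;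
  reg : X -> \bar R;
  gY : Y -> R;
  feasY : set Y;
  openX : set X;
  openY : set Y;
  Phi : X -> Y -> R;
  omX : X -> \bar R;
  omY : Y -> \bar R }.

Section Method.
Context {R : realType} {X Y : normedModType R}.
Variable P : problem X Y.

Definition domX : set X := edom (reg P).

Definition f_obj (x : X) : \bar R :=
  ereal_sup [set (Phi P x y - gY P y)%:E | y in feasY P].

Definition q_obj (x : X) : \bar R := (f_obj x + reg P x)%E.

Definition q_star : \bar R := ereal_inf (range q_obj).

Definition RYe : \bar R := ereal_sup [set `|omY P y|%E | y in feasY P].

Definition RY : R := fine RYe.

Record problem_ok : Prop := {
  reg_proper : forall x, reg P x <> -oo%E;
  reg_closed : lower_semicontinuous (reg P);
  reg_convex : econvex (reg P);
  domX_nonempty : domX !=set0;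
  domX_closed : closed domX;
  feasY_nonempty : feasY P !=set0;
  feasY_convex : convex_set (feasY P);
  feasY_compact : compact (feasY P);
  gY_convex : convex_function (feasY P) (gY P);
  gY_continuous : {within feasY P, continuous (gY P)};
  openX_open : open (openX P);
  openY_open : open (openY P);
  openX_sub : domX `<=` openX P;
  openY_sub : feasY P `<=` openY P;
  Phi_continuous : {within openX P `*` openY P,
    continuous (fun p : X * Y => Phi P p.1 p.2)};
  Phi_concave : forall x, domX x -> convex_function (feasY P) (\- Phi P x);
  q_bounded_below : (-oo < q_star)%E;
  Lxy_ge0 : 0 <= Lxy P;
  Lyy_ge0 : 0 <= Lyy P;
  (* The parameter 2 * (Lyy + Lxy^2 / mu) of the dual solver is positive. *)
  Lxy_Lyy_gt0 : 0 < Lxy P + Lyy P;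
  Phi_diff_x : forall x y, openX P x -> feasY P y ->
    differentiable (Phi P ^~ y) x;
  grad_x_lip_x : forall x x' y, domX x -> domX x' -> feasY P y ->
    dual_norm ('d (Phi P ^~ y) x \- 'd (Phi P ^~ y) x') <= Lxx P * `|x - x'|;
  grad_x_lip_y : forall x y y', domX x -> feasY P y -> feasY P y' ->
    dual_norm ('d (Phi P ^~ y) x \- 'd (Phi P ^~ y') x) <= Lxy P * `|y - y'|;
  gamma_gt0 : 0 < gamma P;
  gamma_le : gamma P <= Lxx P;
  weakly_convex : forall x x' y, domX x -> domX x' -> feasY P y ->
    - (gamma P / 2) * `|x' - x| ^+ 2
      <= Phi P x' y - Phi P x y - 'd (Phi P ^~ y) x (x' - x);
  Phi_diff_y : forall x y, domX x -> openY P y -> differentiable (Phi P x) y;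
  grad_y_lip_x : forall x x' y, domX x -> domX x' -> feasY P y ->
    dual_norm ('d (Phi P x) y \- 'd (Phi P x') y) <= Lxy P * `|x - x'|;
  grad_y_lip_y : forall x y y', domX x -> feasY P y -> feasY P y' ->
    dual_norm ('d (Phi P x) y \- 'd (Phi P x) y') <= Lyy P * `|y - y'|;
  omX_dgf : DGF domX (omX P);
  omX_C2 : C2_on (interior (edom (omX P))) (fine \o omX P);
  domX_sub_omX : domX `<=` interior (edom (omX P));
  betaX_ge1 : 1 <= betaX P;
  omX_lip : forall x x', domX x -> domX x' ->
    dual_norm ('d (fine \o omX P) x \- 'd (fine \o omX P) x')
      <= betaX P * `|x - x'|;
  omY_dgf : DGF (feasY P) (omY P);
  RY_gt0 : (0 < RYe)%E;
  RY_fin : (RYe < +oo)%E;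
  prox_X : bregman_prox_solvable domX (reg P) (omX P);
  prox_Y : bregman_prox_solvable (feasY P) (EFin \o gY P) (omY P) }.

Definition f_smooth (rho : R) (x : X) : \bar R :=
  ereal_sup [set ((Phi P x y - gY P y)%:E - rho%:E * omY P y)%E
            | y in feasY P].

Definition q_smooth (rho : R) (x : X) : \bar R := (f_smooth rho x + reg P x)%E.

(* The function x' |-> Q_rho^lam(x'; x). *)
Definition Q_smooth (rho lam : R) (x x' : X) : \bar R :=
  (q_smooth rho x' + lam^-1%:E * bregman (omX P) x' x)%E.

Definition q_env (rho lam : R) (x : X) : \bar R :=
  ereal_inf (range (Q_smooth rho lam x)).

(* p = prox(q, x, lam). *)
Definition is_prox (lam : R) (x p : X) : Prop :=
  argmin_on setT (fun x' => q_obj x' + lam^-1%:E * bregman (omX P) x' x)%E p.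

Definition near_stationary (eps : R) (x : X) : Prop :=
  domX x /\
  exists (lam : R) (p : X), [/\ 0 < lam < (gamma P)^-1, is_prox lam x p &
                                `|lam^-1 *: (x - p)| <= eps / betaX P].

Definition rho_of (eta : R) : R := 2 * eta / RY.

Definition stops (lam eta : R) (x : nat -> X) (k : nat) : Prop :=
  `|x k.+1 - x k| <= Num.sqrt (2 * eta / (lam^-1 - gamma P)).

(* A terminated run of the primal-dual smoothing framework: iterates are
   numbered from 1, K is the last iteration and x K is the output. *)
Definition smoothing_framework (lam eta : R) (x1 : X) (x : nat -> X) (K : nat)
  : Prop :=
  [/\ (0 < K)%N,
      x 1%N = x1,
      forall k, (0 < k <= K)%N ->
        domX (x k.+1) /\
        (Q_smooth (rho_of eta) lam (x k) (x k.+1)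
          <= q_env (rho_of eta) lam (x k) + eta%:E)%E,
      stops lam eta x K &
      forall k, (0 < k < K)%N -> ~ stops lam eta x k].

Definition mu_of (lam : R) : R := lam^-1 - gamma P.

Definition Lxx' : R := Lxx P + gamma P * betaX P.

Definition Lpi (lam : R) : R := Lyy P + Lxy P ^+ 2 / mu_of lam.

Definition epsbar (lam eta : R) : R :=
  eta / (2 * (1 + Num.sqrt (2 * Lpi lam / rho_of eta))).

Definition Psi (lam : R) (xk x : X) (y : Y) : R :=
  gamma P * fine (omX P x) - lam^-1 * 'd (fine \o omX P) xk x + Phi P x y.

Definition psiP (lam : R) (xk x : X) (y : Y) : \bar R :=
  ((Psi lam xk x y)%:E + reg P x + (mu_of lam)%:E * omX P x)%E.

Definition pi_dual (lam : R) (xk : X) (y : Y) : \bar R :=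
  ereal_inf [set psiP lam xk x y | x in domX].

Definition saddle (lam rho : R) (xk x : X) (y : Y) : \bar R :=
  ((mu_of lam)%:E * omX P x + reg P x + (Psi lam xk x y)%:E - (gY P y)%:E
   - rho%:E * omY P y)%E.

Definition duality_gap (lam rho : R) (xk x : X) (y : Y) : \bar R :=
  (ereal_sup [set saddle lam rho xk x y' | y' in feasY P]
   - ereal_inf [set saddle lam rho xk x' y | x' in domX])%E.

(* The inner solver run on min_x psiP(x, y) until apg_z is acc-optimal. *)
Definition primal_solve (lam acc : R) (xk : X) (y : Y) (n : nat)
    (tr : apg_trace X) : Prop :=
  is_apg domX (omX P) (reg P) (mu_of lam) Lxx'
    (fun t => 'd ((Psi lam xk) ^~ y) (apg_u tr t)) n tr /\
  first_index (fun t => psiP lam xk (apg_z tr t) y - pi_dual lam xk y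
                        <= acc%:E)%E n.

Definition xbar (theta : R) (xhat : nat -> X) (t : nat) : X :=
  (apg_A theta t)^-1 *: \sum_(0 <= i < t.+1) apg_alpha theta i *: xhat i.

(* The outer solver run on the dual problem, with the inexact gradients
   obtained from xhat, until the duality gap at (xbar_n, z_n) is at most eta. *)
Definition dual_solve (lam eta : R) (xk : X) (xhat : nat -> X) (n : nat)
    (tr : apg_trace Y) (xnext : X) : Prop :=
  let rho := rho_of eta in
  let L := 2 * Lpi lam in
  [/\ is_apg (feasY P) (omY P) (EFin \o gY P) rho L
        (fun t v => - 'd (Psi lam xk (xhat t)) (apg_u tr t) v) n tr,
      first_index (fun t => duality_gap lam rho xk (xbar (rho / L) xhat t)
                              (apg_z tr t) <= eta%:E)%E n &
      xnext = xbar (rho / L) xhat n].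

End Method.

(* Log of an execution.  During outer iteration k (numbered from 1), the dual
   solver performs dual_len k iterations, with trace dual_tr k; at its i-th
   query point the inner solver performs primal_len k i iterations, with trace
   primal_tr k i. *)
Record pd_log (X Y : Type) := PdLog {
  iter_x : nat -> X;
  dual_tr : nat -> apg_trace Y;
  dual_len : nat -> nat;
  primal_tr : nat -> nat -> apg_trace X;
  primal_len : nat -> nat -> nat }.

(* xhat log k i is the inner solution at the i-th dual query point. *)
Definition xhat (X Y : Type) (log : pd_log X Y) (k i : nat) : X :=
  apg_z (primal_tr log k i) (primal_len log k i).

(* The first K outer iterations, none of which but possibly the last one
   satisfies the termination test. *)
Definition pd_run (R : realType) (X Y : normedModType R) (P : problem X Y)
    (lam eta : R) (x1 : X) (log : pd_log X Y) (K : nat) : Prop :=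
  let x := iter_x log in
  [/\ x 1%N = x1,
      forall k, (0 < k <= K)%N ->
        (forall i, (i <= dual_len log k)%N ->
           primal_solve P lam (epsbar P lam eta / 2) (x k)
             (apg_u (dual_tr log k) i) (primal_len log k i)
             (primal_tr log k i)) /\
        dual_solve P lam eta (x k) (xhat log k) (dual_len log k)
          (dual_tr log k) (x k.+1) &
      forall k, (0 < k < K)%N -> ~ stops P lam eta x k].

Definition terminates (R : realType) (X Y : normedModType R) (P : problem X Y)
    (lam eta : R) (log : pd_log X Y) (K : nat) : Prop :=
  (0 < K)%N /\ stops P lam eta (iter_x log) K.

Definition starts_at (X Y : Type) (log : pd_log X Y) (K : nat)
    (sx : nat -> nat -> X) (sy : nat -> Y) : Prop :=
  forall k, (0 < k <= K)%N ->
    apg_u (dual_tr log k) 0 = sy k /\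
    forall i, (i <= dual_len log k)%N ->
      apg_u (primal_tr log k i) 0 = sx k i.

(* D bounds the Bregman distances from the starting points of the solvers:
   to the points of feasY for the dual solver, and to the solution of the inner
   problem for each run of the inner solver. *)
Definition starts_within (R : realType) (X Y : normedModType R)
    (P : problem X Y) (lam D : R) (log : pd_log X Y) (K : nat) : Prop :=
  forall k, (0 < k <= K)%N ->
    (forall y, feasY P y ->
       (bregman (omY P) y (apg_u (dual_tr log k) 0) <= D%:E)%E) /\
    forall i, (i <= dual_len log k)%N ->
      forall xs, argmin_on (domX P)
          (fun x => psiP P lam (iter_x log k) x (apg_u (dual_tr log k) i)) xs ->
        (bregman (omX P) xs (apg_u (primal_tr log k i) 0) <= D%:E)%E.

(* Numbers of evaluations of the partial gradients of Phi: each query point of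
   the inner (resp. dual) solver costs one evaluation in x (resp. in y). *)
Definition primal_complexity (X Y : Type) (log : pd_log X Y) (K : nat) : nat :=
  (\sum_(1 <= k < K.+1) \sum_(0 <= i < (dual_len log k).+1)
     (primal_len log k i).+1)%N.

Definition dual_complexity (X Y : Type) (log : pd_log X Y) (K : nat) : nat :=
  (\sum_(1 <= k < K.+1) (dual_len log k).+1)%N.

Definition lam_of (R : realType) (c : constants R) : R :=
  9%:R / 10%:R * (gamma c)^-1.

Definition eta_of (R : realType) (c : constants R) (eps : R) : R :=
  eps ^+ 2 * lam_of c * (1 - gamma c * lam_of c) / (32%:R * betaX c ^+ 2).

(* Main.v *)
Require Import Defs.
From HB Require Import structures.
From mathcomp Require Import all_boot all_order all_algebra.
From mathcomp Require Import all_classical all_reals all_analysis.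
From mathcomp Require Import ring lra.

Set Implicit Arguments.
Unset Strict Implicit.
Unset Printing Implicit Defensive.

Import Order.TTheory GRing.Theory Num.Theory.
Import numFieldNormedType.Exports.

Local Open Scope classical_set_scope.
Local Open Scope ring_scope.

(** The proof combines an outer descent argument, one accelerated-method
    analysis that serves both solvers, and a count of the resulting iterations.

    Outer loop.  Every [Phi ^~ y] is weakly convex with modulus [gamma] and the
    distance generating function is 1-strongly convex, so adding [1 / lam] times
    the Bregman distance to the centre [xk] makes the objective strongly convex
    with modulus [mu = 1 / lam - gamma]; a maximum over [y] inherits this,
    whatever function of [y] is subtracted ([pen_prox_obj_convex]).  A step that
    does not stop is long, and its Bregman term forces the smoothed objective
    down by [9 * eta] ([stop_descent]).  Smoothing moves the objective by at most
    [2 * eta], hence the number of iterations is at most about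
    [Delta / (9 * eta)] ([run_length]).  At a stopping step, strong convexity
    turns an excess of [5 * eta] over the optimal value of the exact proximal
    problem into a distance to the proximal point ([near_stationary_stop]).

    Solvers.  The accelerated method keeps an average of affine lower models of
    the smooth part, with weights growing like [(1 + sqrt theta) ^ t], and its
    iterate is as good as the minimum of that average plus the composite term
    ([apg_estimate_bound]).  For the primal solver the models are tangents.  For
    the dual solver the model at a query [yt] is the tangent at [yt] of
    [- inner_obj xh], where [xh] is the approximate inner solution: it lies below
    [- inner_obj xh] and, up to the inner accuracy, it gives an upper bound of
    the dual function with curvature [2 * Lpi] ([dual_lower], [dual_upper]).
    Since the lower bound holds for the individual functions [- inner_obj xh],
    Jensen's inequality for the averaged point turns the estimate into a bound
    on the duality gap ([dual_apg_bound], [dual_apg_gap]).  The inner errors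
    accumulate by a factor [1 + 1 / sqrt theta], which is the factor that
    [epsbar] divides [eta] by.

    Counting.  A solver that has not stopped at step [t] still has
    [(1 + sqrt theta) ^ t] below a polynomial in [1 / eps], so it runs for
    [O (ln (1 / eps) / sqrt theta)] steps ([iteration_count]).  Here
    [1 / sqrt theta] is of order [sqrt (Lxx / gamma)] for the primal solver and
    of order [(sqrt (Lyy * gamma) + Lxy) / eps] for the dual one, and there are
    [O (gamma / eps ^ 2)] outer iterations; multiplying gives both bounds. *)

(** * Linear functionals and Frechet differentials *)

Section Scalars.
Context {R : realType} {V : normedModType R}.

(** The solvability hypothesis quantifies over bundled linear maps, while the
    accumulated gradients of a solver are plain functions. *)
Lemma scalar_linear (l : V -> R) : scalar l ->
  exists l' : {linear V -> R}, forall v, l' v = l v.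
Proof.
move=> ll; pose m := GRing.isLinear.Build R V R *:%R l ll.
by exists (HB.pack_for {linear V -> R} l m).
Qed.

Lemma scalarD (l1 l2 : V -> R) : scalar l1 -> scalar l2 ->
  scalar (fun v => l1 v + l2 v).
Proof. by move=> h1 h2 a u v /=; rewrite h1 h2 mulrDr; ring. Qed.

Lemma scalarZ (l : V -> R) a : scalar l -> scalar (fun v => a * l v).
Proof. by move=> h b u v /=; rewrite h; ring. Qed.

Lemma scalar_comb (l : V -> R) a b u v : scalar l ->
  l (a *: u + b *: v) = a * l u + b * l v.
Proof. by move=> /scalar_linear[l' El]; rewrite -!El linearD !linearZ. Qed.

Lemma scalar_diff (f : V -> R) x : scalar ('d f x).
Proof. by move=> a u v; rewrite linearP. Qed.

Lemma convex_comb_shift (s : R) (u w : V) :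
  s *: u + (1 - s) *: w = w + s *: (u - w).
Proof. by rewrite scalerBl scale1r scalerBr addrCA addrA. Qed.

End Scalars.

Section Differentials.
Context {R : realType} {V : normedModType R}.
Implicit Types (f : V -> R) (x d v w : V).

(** The explicit bound [M] matters: the supremum of an unbounded set is a
    default value. *)
Lemma le_dual_norm (l : V -> R) (M : R) v :
  scalar l -> (forall w, `|l w| <= M * `|w|) -> l v <= dual_norm l * `|v|.
Proof.
move=> ll lM.
have lZ a w : l (a *: w) = a * l w.
  by have [l' El] := scalar_linear ll; rewrite -!El linearZ.
have [->|v0] := eqVneq v 0.
  by rewrite -(scale0r 0) lZ mul0r scale0r normr0 mulr0.
have nv : 0 < `|v| by rewrite normr_gt0.
rewrite -ler_pdivrMr // mulrC -lZ.
apply: sup_ubound.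
  exists `|M| => _ [w /= w1 <-].
  apply: le_trans (ler_norm _) _; apply: le_trans (lM w) _.
  apply: le_trans (ler_norm _) _; rewrite normrM normr_id.
  by rewrite -[leRHS]mulr1 ler_wpM2l.
by exists (`|v|^-1 *: v) => //=; rewrite normrZ ger0_norm ?invr_ge0 // mulVf ?gt_eqF.
Qed.

Lemma diff_bounded f x : differentiable f x ->
  exists M, forall w, `|'d f x w| <= M * `|w|.
Proof.
move=> df.
have c0 : {for 0, continuous ('d f x)} by apply: diff_continuous.
have /linear_boundedP := continuous_linear_bounded 0 c0.
move=> [M [_ HM]]; exists (M + 1) => w; apply: (HM (M + 1)); lra.
Qed.

Lemma le_dual_diffB f g x y v : differentiable f x -> differentiable g y ->
  'd f x v - 'd g y v <= dual_norm ('d f x \- 'd g y) * `|v|.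
Proof.
move=> df dg; have [M HM] := diff_bounded df; have [N HN] := diff_bounded dg.
rewrite -/(('d f x \- 'd g y) v).
apply: (@le_dual_norm _ (M + N)).
  by move=> a u w /=; rewrite !linearP /=; rewrite mulrBr -!/(_ *: _ : R^o); ring.
by move=> w /=; apply: le_trans (ler_normB _ _) _; rewrite mulrDl lerD.
Qed.

(** Restricting the difference quotient to positive steps turns a convexity
    inequality along a ray into a bound on the differential. *)
Lemma diff_dir_le f x d (c k : R) : differentiable f x ->
  (forall s, 0 < s <= 1 -> f (x + s *: d) - f x <= s * (c + s * k)) ->
  'd f x d <= c.
Proof.
move=> df H; rewrite -deriveE //.
have cv := cvg_dnbhs_at_right (diff_derivable (v := d) df).
have cv2 : (c + s * k) @[s --> (0:R)^'+] --> c.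
  rewrite -[X in _ --> X]addr0 -{2}(mul0r k).
  apply: cvgD; first exact: cvg_cst.
  apply: cvgMl; apply: cvg_at_right_filter; exact: cvg_id.
apply: (ler_cvg_to cv cv2).
near=> s.
have s0 : 0 < s by near: s; exact: nbhs_right_gt.
have s1 : s <= 1 by near: s; apply: nbhs_right_le.
rewrite /= -[X in X <= _]/(s^-1 * _) ler_pdivrMl // [s *: d + x]addrC.
by apply: H; rewrite s0 s1.
Unshelve. all: by end_near. Qed.

Lemma diff_dir_ge f x d (c : R) : differentiable f x ->
  (forall s, 0 < s <= 1 -> s * c <= f (x + s *: d) - f x) ->
  c <= 'd f x d.
Proof.
move=> df H; rewrite -deriveE //.
have cv := cvg_dnbhs_at_right (diff_derivable (v := d) df).
apply: (ler_cvg_to (cvg_cst c) cv).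
near=> s.
have s0 : 0 < s by near: s; exact: nbhs_right_gt.
have s1 : s <= 1 by near: s; apply: nbhs_right_le.
rewrite /= -[X in _ <= X]/(s^-1 * _) ler_pdivlMl // [s *: d + x]addrC.
by apply: H; rewrite s0 s1.
Unshelve. all: by end_near. Qed.

(** Along a segment, the mean value theorem applied to the gap between [f] and
    its quadratic model reduces the claim to the sign of a derivative. *)
Lemma descent_lemma f x d (L : R) :
  (forall s : R, 0 <= s <= 1 -> differentiable f (x + s *: d)) ->
  (forall s : R, 0 <= s <= 1 -> 'd f (x + s *: d) d - 'd f x d <= L * s) ->
  f (x + d) <= f x + 'd f x d + L / 2.
Proof.
move=> df HL.
pose line (s : R) : V := x + s *: d.
have dline (s : R) : is_diff s line ( *:%R ^~ d).
  have -> : line = cst x + ( *:%R ^~ d) by [].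
  by apply: is_diff_eq; rewrite add0r.
have dfl (s : R) : 0 <= s <= 1 -> is_derive s 1 (f \o line) ('d f (line s) d).
  move=> s01; have dfs : is_diff (line s) f ('d f (line s)).
    by apply: DiffDef => //; exact: df.
  have dc := is_diff_comp (dline s) dfs.
  apply: DeriveDef; first by apply: diff_derivable; exact: ex_diff.
  by rewrite deriveE ?diff_val /= ?scale1r //; exact: ex_diff.
pose m (s : R) : R := s * 'd f x d + L / 2 * (s * s).
have dm (s : R) : is_derive s 1 m ('d f x d + L * s).
  rewrite /m; apply: is_derive_eq; rewrite /GRing.scale /=; lra.
have dph (s : R) : 0 <= s <= 1 ->
    is_derive s 1 (f \o line - m) ('d f (line s) d - ('d f x d + L * s)).
  by move=> s01; apply: is_deriveB; exact: dfl.
have oc (s : R) : s \in `]0, 1[ -> 0 <= s <= 1.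
  by rewrite in_itv /= => /andP[s0 s1]; rewrite !ltW.
have : (f \o line - m) 1 <= (f \o line - m) 0.
  apply: (@ler0_derive1_le_cc _ _ 0 1) => //.
  - by move=> s /oc s01; have ds := dph s s01; exact: ex_derive.
  - move=> s /oc s01; have := dph s s01 => ds; rewrite derive1E derive_val.
    by have := HL s s01; rewrite -/(line s); lra.
  - apply: derivable_within_continuous => s; rewrite in_itv /= => s01.
    by have ds := dph s s01; exact: ex_derive.
  - by rewrite in_itv /= ler01 lexx.
  - by rewrite in_itv /= ler01 lexx.
rewrite /m /line !fctE /= scale1r scale0r addr0; lra.
Qed.

Lemma descent_lemma_lower f x d (L : R) :
  (forall s : R, 0 <= s <= 1 -> differentiable f (x + s *: d)) ->
  (forall s : R, 0 <= s <= 1 -> 'd f x d - 'd f (x + s *: d) d <= L * s) ->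
  f x + 'd f x d - L / 2 <= f (x + d).
Proof.
move=> df HL.
have dN z : differentiable f z -> 'd (- f) z d = - 'd f z d.
  by move=> dfz; rewrite diffN.
have df0 : differentiable f x.
  by have := df 0; rewrite scale0r addr0; apply; rewrite lexx ler01.
have := @descent_lemma (- f) x d L; rewrite dN // !fctE => h.
suff : - f (x + d) <= - f x + - 'd f x d + L / 2 by lra.
apply: h => s s01; first by apply: differentiableN; exact: df.
rewrite dN; last exact: df.
by have := HL s s01; lra.
Qed.

End Differentials.

(** * Minimisation in finite dimension *)

Section FiniteDimension.
Context {R : realType} {V : normedModType R}.

(** A linear dependency lets one generator be dropped, so a generating family
    of minimal size is free. *)
Lemma finite_dimensional_basis : finite_dimensional V ->
  exists (n : nat) (e : 'I_n -> V),
    (forall v, exists c : 'I_n -> R, v = \sum_i c i *: e i) /\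
    (forall c : 'I_n -> R, \sum_i c i *: e i = 0 -> forall i, c i = 0).
Proof.
move=> [n]; elim: n => [|n IH] [e se].
  by exists 0%N, e; split=> // c _ [].
have [indep|] := pselect (forall c : 'I_n.+1 -> R,
    \sum_i c i *: e i = 0 -> forall i, c i = 0); first by exists n.+1, e.
move=> /existsNP[c /not_implyP[c0 /existsNP[j /eqP cj]]].
apply: IH; exists (fun i => e (lift j i)) => v; have [a ->] := se v.
exists (fun i => a (lift j i) - a j * (c j)^-1 * c (lift j i)).
have := c0; rewrite !(bigD1_ord j) //= => /eqP; rewrite addrC addr_eq0 => /eqP H.
have -> : e j = - (c j)^-1 *: \sum_i c (lift j i) *: e (lift j i).
  by rewrite H scalerN scaleNr opprK scalerA mulVf // scale1r.
rewrite scalerA scaler_sumr -big_split /=; apply: eq_bigr => i _.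
rewrite scalerA -scalerDl; congr (_ *: _); ring.
Qed.

(** The coordinates of a vector in a basis are bounded by its norm: on the
    compact unit sphere of coordinates, the norm has a positive minimum. *)
Lemma finite_dimensional_complete : finite_dimensional V ->
  forall u : nat -> V,
  (forall e : R, 0 < e -> exists N, forall i j, (N <= i)%N -> (N <= j)%N ->
     `|u i - u j| <= e) ->
  exists l : V, u @ \oo --> l.
Proof.
move=> /finite_dimensional_basis[n [e [se ie]]] u cu.
pose T (c : 'rV[R]_n) : V := \sum_i c ord0 i *: e i.
have TB c d : T (c - d) = T c - T d.
  rewrite /T -sumrB; apply: eq_bigr => i _.
  by rewrite !mxE scalerBl.
have TZ a c : T (a *: c) = a *: T c.
  by rewrite /T scaler_sumr; apply: eq_bigr => i _; rewrite mxE scalerA.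
have T0 c : T c = 0 -> c = 0.
  move=> Tc; apply/rowP => i; rewrite mxE.
  exact: (ie (fun i => c ord0 i) Tc i).
have cT : continuous T.
  apply: continuous_big => [|i _]; first exact: add_continuous.
  move=> c; have h : (fun M : 'rV[R]_n => M ord0 i) x @[x --> c] --> c ord0 i.
    exact: coord_continuous.
  exact: cvgZr_tmp h.
have [m m0 Hm] : exists2 m : R, 0 < m & forall c, m * `|c| <= `|T c|.
  pose S : set 'rV[R]_n := [set c | `|c| = 1].
  have [[c0 Sc0]|S0] := pselect (S !=set0); last first.
    exists 1 => // c; have [->|c0] := eqVneq c 0; first by rewrite normr0 mulr0.
    exfalso; apply: S0; exists (`|c|^-1 *: c); rewrite /S /= normrZ normfV normr_id.
    by rewrite mulVf // normr_eq0.
  have cS : compact S.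
    apply: bounded_closed_compact.
      exists 1; split => // M M1 c; rewrite /S /= => ->; exact: ltW.
    have -> : S = (fun c : 'rV[R]_n => `|c|) @^-1` [set 1] by [].
    apply: preimage_closed => [c _|]; first exact: norm_continuous.
    exact: closed_eq.
  have [|c Sc Hc] := @EVT_min_rV _ _ (fun c => `|T c|) S
    (ex_intro _ c0 Sc0) cS.
    apply: continuous_subspaceT => d.
    have h := cT d; exact: cvg_norm h.
  exists `|T c|.
    rewrite normr_gt0; apply/negP => /eqP /T0 c00.
    by move: Sc; rewrite inE /S /= c00 normr0 => /eqP; rewrite eq_sym oner_eq0.
  move=> d; have [->|d0] := eqVneq d 0; first by rewrite normr0 mulr0.
  have dp : 0 < `|d| by rewrite normr_gt0.
  have := Hc (`|d|^-1 *: d); rewrite TZ normrZ normfV normr_id.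
  rewrite ler_pdivlMl // mulrC; apply; rewrite inE /S /= normrZ normfV normr_id.
  by rewrite mulVf // gt_eqF.
have /choice[c Hc] : forall k, exists c, T c = u k.
  move=> k; have [a ua] := se (u k); exists (\row_i a i).
  by rewrite /T ua; apply: eq_bigr => i _; rewrite mxE.
have : cvg (c @ \oo).
  apply/cauchy_cvgP/cauchy_exP => eps eps0.
  have [N HN] := cu (m * (eps / 2)) ltac:(by rewrite !mulr_gt0 ?invr_gt0).
  exists (c N); exists N => // k /= Nk; rewrite -ball_normE /=.
  have := HN N k (leqnn _) Nk; rewrite -!Hc -TB.
  move=> /(le_trans (Hm _)); rewrite ler_pM2l // => H.
  apply: le_lt_trans H _; lra.
move=> /cvg_ex[l cl]; exists (T l).
have -> : u = T \o c by apply/funext => k; rewrite /= Hc.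
by apply: continuous_cvg => //; exact: cT.
Qed.

(** Strong convexity at midpoints makes every minimising sequence Cauchy, and
    the closed sublevel sets contain its limit. *)
Lemma strongly_convex_minimizer (S : set V) (F : V -> R) (m : R) :
  finite_dimensional V -> 0 < m -> S !=set0 ->
  (forall u v, S u -> S v -> S (2^-1 *: u + 2^-1 *: v) /\
     F (2^-1 *: u + 2^-1 *: v) + m * `|u - v| ^+ 2 <= (F u + F v) / 2) ->
  (exists b, forall u, S u -> b <= F u) ->
  (forall c, closed [set u | S u /\ F u <= c]) ->
  exists2 u, S u & forall v, S v -> F u <= F v.
Proof.
move=> fV m0 [u0 Su0] sc [b Fb] cl.
pose I := inf (F @` S).
have hI : has_inf (F @` S).
  split; first by exists (F u0), u0.
  by exists b => _ [u Su <-]; exact: Fb.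
have FI u : S u -> I <= F u by move=> Su; apply: ge_inf; [exact: hI.2|exists u].
have /choice[u Hu] : forall k : nat, exists u, S u /\ F u <= I + k.+1%:R^-1.
  move=> k; have k0 : 0 < (k.+1%:R : R)^-1 by rewrite invr_gt0.
  have [_ [u Su <-] Hu] := inf_adherent k0 hI.
  by exists u; split => //; exact: ltW.
have cvi (e : R) : 0 < e -> exists N, forall k, (N <= k)%N -> (k.+1%:R)^-1 <= e.
  move=> e0; exists (Num.truncn e^-1) => k Nk.
  rewrite invf_ple ?posrE //; apply: le_trans (ltW (truncnS_gt _)) _.
  by rewrite ler_nat ltnS.
have [|l ul] := finite_dimensional_complete fV (u := u).
  move=> e e0; have [N HN] := cvi (m * e ^+ 2) ltac:(by rewrite mulr_gt0 ?exprn_gt0).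
  exists N => i j Ni Nj; have [Si Fi] := Hu i; have [Sj Fj] := Hu j.
  have [Sm Fm] := sc _ _ Si Sj.
  rewrite -(@ler_pXn2r _ 2) ?nnegrE ?(ltW e0) // -(ler_pM2l m0).
  move: Fm Fi Fj (FI _ Sm) (HN i Ni) (HN j Nj).
  by move: (i.+1%:R^-1) (j.+1%:R^-1) => p q; lra.
have Hl (e : R) : 0 < e -> S l /\ F l <= I + e.
  move=> e0; have [N HN] := cvi e e0.
  apply: (closed_cvg (fun v => S v /\ F v <= I + e) (cl (I + e)) _ l ul).
  exists N => // k Nk /=; have [Sk Fk] := Hu k; split=> //.
  by apply: le_trans Fk _; rewrite lerD2l; exact: HN.
exists l; first by have [] := Hl 1 ltr01.
move=> v Sv; apply/ler_addgt0Pr => e e0; have [_] := Hl e e0.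
have := FI v Sv; lra.
Qed.

End FiniteDimension.

(** * Weights of the accelerated method *)

Section Weights.
Context {R : realType}.
Implicit Types theta : R.

Lemma apg_AS theta t : apg_A theta t.+1 = apg_A theta t + apg_alpha theta t.+1.
Proof. by rewrite /apg_A big_nat_recr. Qed.

Lemma apg_AE theta t : apg_A theta t = (1 + Num.sqrt theta) ^+ t.
Proof.
elim: t => [|t IH]; first by rewrite /apg_A big_nat1.
by rewrite apg_AS IH /= exprS; ring.
Qed.

Lemma apg_A_gt0 theta t : 0 < apg_A theta t.
Proof. by rewrite apg_AE exprn_gt0 // ltr_pwDl // sqrtr_ge0. Qed.

Lemma apg_alpha_ge0 theta t : 0 <= apg_alpha theta t.
Proof.
by case: t => [|t] //=; rewrite mulr_ge0 ?sqrtr_ge0 // exprn_ge0.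
Qed.

Lemma apg_alpha_gt0 theta t : 0 < theta -> 0 < apg_alpha theta t.
Proof.
by move=> th0; case: t => [|t] //=; rewrite mulr_gt0 ?sqrtr_gt0 // exprn_gt0.
Qed.

Lemma apg_tau_itv theta t : 0 <= apg_tau theta t.+1 <= 1.
Proof.
rewrite /apg_tau ler_pdivlMr ?apg_A_gt0 // mul0r apg_alpha_ge0 /=.
by rewrite ler_pdivrMr ?apg_A_gt0 // mul1r apg_AS lerDr ltW // apg_A_gt0.
Qed.

(** The condition on the weights under which the curvature of the estimate
    function pays for the quadratic error of one step. *)
Lemma apg_alpha_sqr_le theta t : 0 <= theta ->
  apg_alpha theta t.+1 ^+ 2 <= (apg_A theta t * theta + 1) * apg_A theta t.+1.
Proof.
move=> th0; rewrite apg_AS /= -apg_AE.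
move: (apg_A theta t) (apg_A_gt0 theta t) => A A0.
have := sqr_sqrtr th0; move: (Num.sqrt theta) (sqrtr_ge0 theta) => r r0 <-.
rewrite -subr_ge0; set X := (X in 0 <= X).
have -> : X = A ^+ 2 * r ^+ 3 + A + A * r by rewrite /X; ring.
by rewrite !addr_ge0 // ?mulr_ge0 ?exprn_ge0 // ltW.
Qed.

(** The gradient errors add up with the weights [apg_A theta i], a geometric
    sequence. *)
Lemma sum_apg_A_le theta t : 0 < theta ->
  \sum_(0 <= i < t.+1) apg_A theta i
    <= apg_A theta t * (1 + (Num.sqrt theta)^-1).
Proof.
move=> th0; have s0 : 0 < Num.sqrt theta by rewrite sqrtr_gt0.
elim: t => [|t IH].
  rewrite big_nat1; apply: ler_peMr; first exact/ltW/apg_A_gt0.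
  by rewrite lerDl invr_ge0 ltW.
rewrite big_nat_recr //=; apply: le_trans (lerD IH (lexx _)) _.
rewrite apg_AS /= -apg_AE le_eqVlt; apply/orP; left; apply/eqP.
by field; rewrite gt_eqF.
Qed.

End Weights.

(** * Bregman proximal steps *)

Section ProximalSetup.
Context {R : realType} {V : normedModType R}.

Definition convex_on (U : set V) (f : V -> R) : Prop :=
  forall u v s, U u -> U v -> 0 <= s <= 1 ->
    f (s *: u + (1 - s) *: v) <= s * f u + (1 - s) * f v.

(** The common part of the two composite problems, over [X] and over [Y].  The
    extended-real functions are finite on [U], where all arguments take place in
    the reals. *)
Record prox_setup (U : set V) (zeta om : V -> \bar R) : Prop := {
  ps_convex : forall u v s, U u -> U v -> 0 <= s <= 1 ->
    U (s *: u + (1 - s) *: v);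
  ps_om_fin : forall u, U u -> om u = (fine (om u))%:E;
  ps_zeta_fin : forall u, U u -> zeta u = (fine (zeta u))%:E;
  ps_om_convex : strongly_convex_on 1 U om;
  ps_zeta_convex : convex_on U (fine \o zeta);
  ps_diff : forall u, interior (edom om) u -> differentiable (fine \o om) u;
  ps_solvable : bregman_prox_solvable U zeta om }.

Variables (U : set V) (zeta om : V -> \bar R).
Hypothesis PS : prox_setup U zeta om.

Let Uo := dgf_interior U om.
Let omr : V -> R := fine \o om.
Let zr : V -> R := fine \o zeta.

Definition breg (f : V -> R) (u' u : V) : R := f u' - f u - 'd f u (u' - u).

Lemma bregmanE u' u : U u' -> U u -> bregman om u' u = (breg omr u' u)%:E.
Proof.
move=> Uu' Uu; rewrite /bregman (ps_om_fin PS Uu') (ps_om_fin PS Uu).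
by rewrite -!EFinB.
Qed.

Lemma om_convex u v s : U u -> U v -> 0 <= s <= 1 ->
  omr (s *: u + (1 - s) *: v) + s * (1 - s) / 2 * `|u - v| ^+ 2
    <= s * omr u + (1 - s) * omr v.
Proof.
move=> Uu Uv s01; have Us := ps_convex PS Uu Uv s01.
have := ps_om_convex PS Uu Uv s01.
rewrite (ps_om_fin PS Uu) (ps_om_fin PS Uv) (ps_om_fin PS Us).
rewrite -!EFinM -!EFinD lee_fin /omr /=; lra.
Qed.

Lemma om_convex_on : convex_on U omr.
Proof.
move=> u v s Uu Uv /[dup] s01 /andP[s0 s1].
apply: le_trans (om_convex Uu Uv s01); rewrite lerDl.
by rewrite mulr_ge0 ?exprn_ge0 // divr_ge0 // mulr_ge0 // subr_ge0.
Qed.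

(** Strong convexity of [om] along a segment, in the limit at its endpoint. *)
Lemma breg_ge u u' : Uo u -> U u' -> `|u' - u| ^+ 2 / 2 <= breg omr u' u.
Proof.
move=> [Uu iu] Uu'.
suff : 'd omr u (u' - u) <= omr u' - omr u - `|u' - u| ^+ 2 / 2.
  by rewrite /breg; lra.
apply: (@diff_dir_le _ _ _ _ _ _ (`|u' - u| ^+ 2 / 2)) (ps_diff PS iu) _.
move=> s /andP[s0 s1].
have := om_convex Uu' Uu (s := s); rewrite (ltW s0) s1 => /(_ isT).
rewrite convex_comb_shift -/omr => H; nra.
Qed.

(** First-order optimality of [w], rearranged: the differential of [om] at [w]
    is the limit of difference quotients that minimality bounds below. *)
Lemma three_point (H : V -> R) (c : R) (w : V) :
  convex_on U H -> 0 < c -> Uo w ->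
  (forall u, U u -> H w + c * omr w <= H u + c * omr u) ->
  forall u, U u -> H w + c * omr w + c * breg omr u w <= H u + c * omr u.
Proof.
move=> cH c0 [Uw iw] mw u Uu.
suff : (H w - H u) / c <= 'd omr w (u - w).
  rewrite ler_pdivrMr // /breg !mulrBr [_ * c]mulrC; lra.
apply: diff_dir_ge; first exact: ps_diff PS _ iw.
move=> s /andP[s0 s1].
have s01 : 0 <= s <= 1 by rewrite ltW.
have := cH _ _ _ Uu Uw s01; have := mw _ (ps_convex PS Uu Uw s01).
rewrite convex_comb_shift mulrA ler_pdivrMr // mulrBl [_ * c]mulrC mulrBr; lra.
Qed.

Definition minimizer (F : V -> R) (w : V) : Prop :=
  U w /\ forall v, U v -> F w <= F v.

Lemma argmin_onE (Fe : V -> \bar R) (F : V -> R) w :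
  (forall v, U v -> Fe v = (F v)%:E) -> argmin_on U Fe w <-> minimizer F w.
Proof.
move=> E; split=> -[Uw mw]; split=> // v Uv.
  by have := mw v Uv; rewrite !E // lee_fin.
by rewrite !E // lee_fin; exact: mw.
Qed.

(** Dividing the objective by the weight of [zeta] reduces to a Bregman
    proximal problem. *)
Lemma prox_exists (l : V -> R) (e a c : R) : scalar l -> 0 < a -> 0 < c ->
  exists2 w, Uo w &
    forall v, minimizer (fun v => e + l v + a * zr v + c * omr v) v <-> v = w.
Proof.
move=> ll a0 c0.
have [l' El] := scalar_linear (scalarZ a^-1 ll).
have ac : 0 < a / c by rewrite divr_gt0.
have [w Uow Hw] := ps_solvable PS l' ac.
exists w => // v; rewrite -Hw; symmetry.
rewrite (argmin_onE (F := fun v => zr v + a^-1 * l v + c / a * omr v)); last first.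
  move=> u Uu; rewrite El invf_div (ps_om_fin PS Uu) (ps_zeta_fin PS Uu).
  by rewrite -!EFinM -!EFinD.
have E u : e + l u + a * zr u + c * omr u
    = e + a * (zr u + a^-1 * l u + c / a * omr u).
  by field; rewrite gt_eqF.
split=> -[Uv mv]; split=> // u Uu; have := mv u Uu; rewrite !E.
  by rewrite lerD2l ler_pM2l.
by rewrite lerD2l ler_pM2l.
Qed.

End ProximalSetup.

(** * Convergence of the accelerated method *)

Section EstimateSequence.
Context {R : realType} {V : normedModType R}.
Variables (U : set V) (zeta om : V -> \bar R).
Hypothesis PS : prox_setup U zeta om.
Variables (mu L : R) (G : nat -> V -> R).
Hypotheses (mu0 : 0 < mu) (L0 : 0 < L) (Glin : forall t, scalar (G t)).

Let Uo := dgf_interior U om.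
Let omr : V -> R := fine \o om.
Let zr : V -> R := fine \o zeta.
Let theta := mu / L.
Let alpha := apg_alpha theta.
Let A := apg_A theta.

Lemma apg_sE t v : apg_s theta G t v = \sum_(0 <= i < t.+1) alpha i * G i v.
Proof.
elim: t => [|t IH]; first by rewrite big_nat1 mul1r.
by rewrite big_nat_recr //= -IH.
Qed.

Lemma apg_s_scalar t : scalar (apg_s theta G t).
Proof. by elim: t => [|t IH]; [exact: Glin|exact: scalarD IH (scalarZ _ _)]. Qed.

Lemma apg_feasible n tr : is_apg U om zeta mu L G n tr ->
  forall t, (t <= n)%N -> U (apg_u tr t) /\ U (apg_z tr t).
Proof.
move=> [[Uu0 _] [Uz0 _] H]; elim=> [//|t IH] tn.
have [_ Uz] := IH (ltnW tn).
have [[Uub _] -> [Uw _] ->] := H t tn.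
have /andP[t0 t1] := apg_tau_itv theta t.
have Uc a b : U a -> U b -> U ((1 - apg_tau theta t.+1) *: a + apg_tau theta t.+1 *: b).
  move=> Ua Ub; rewrite addrC.
  by apply: (ps_convex PS) => //; rewrite t0.
by split; exact: Uc.
Qed.

Let W t := A t * mu + L.

Lemma estimate_objE (u0 : V) (l : V -> R) (a b c : R) v : U u0 -> U v ->
  ((l v)%:E + a%:E * (zeta v + b%:E * om v) + c%:E * bregman om v u0
  = (l v + a * (zr v + b * omr v) + c * breg omr v u0)%:E)%E.
Proof.
by move=> Uu0 Uv; rewrite (bregmanE PS) // (ps_om_fin PS Uv) (ps_zeta_fin PS Uv).
Qed.

Lemma breg_expand (f : V -> R) u u0 :
  breg f u u0 = f u - 'd f u0 u + ('d f u0 u0 - f u0).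
Proof. by rewrite /breg linearB /=; ring. Qed.

(** Expanding the Bregman divergence leaves an affine term and a multiple of
    [om], so all three minimisations of the method are Bregman proximal
    problems. *)
Lemma composite_prox (u0 : V) (l : V -> R) (a b c : R) : U u0 -> scalar l ->
  0 < a -> 0 < b -> 0 < c ->
  exists2 w, Uo w & forall v,
    minimizer U (fun v => l v + a * (zr v + b * omr v) + c * breg omr v u0) v
    <-> v = w.
Proof.
move=> Uu0 ll a0 b0 c0.
have ll' : scalar (fun v => l v + - c * 'd omr u0 v).
  exact/scalarD/scalarZ/scalar_diff.
have abc : 0 < a * b + c by rewrite addr_gt0 // mulr_gt0.
have [w Uow Hw] := prox_exists PS (c * ('d omr u0 u0 - omr u0)) ll' a0 abc.
exists w => // v; rewrite -Hw.
have E u : l u + a * (zr u + b * omr u) + c * breg omr u u0 =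
    c * ('d omr u0 u0 - omr u0) + (l u + - c * 'd omr u0 u) + a * zr u
    + (a * b + c) * omr u by rewrite breg_expand; ring.
by split=> -[Uv mv]; split=> // u Uu; have := mv u Uu; rewrite -!E.
Qed.

(** [e i + G i v] is the affine lower model at the [i]-th query point. *)
Definition apg_estimate (e : nat -> R) (u0 : V) t v : R :=
  \sum_(0 <= i < t.+1) alpha i * (e i + G i v) + A t * (zr v + mu * omr v)
  + L * breg omr v u0.

(** Up to affine terms the estimate function is convex plus [W t] times [om], so
    the three-point inequality applies with weight [W t]. *)
Lemma estimate_growth (e : nat -> R) u0 t ub : U u0 ->
  argmin_on U (fun v => (apg_s theta G t v)%:E
     + (A t)%:E * (zeta v + mu%:E * om v) + L%:E * bregman om v u0)%E ub ->
  Uo ub /\ forall v, U v -> apg_estimate e u0 t ub + W t * breg omr v ub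
     <= apg_estimate e u0 t v.
Proof.
move=> Uu0; rewrite (argmin_onE _ (fun v Uv => estimate_objE _ _ _ _ Uu0 Uv)).
have A0 : 0 < A t := apg_A_gt0 _ _.
have [w Uow Hw] := composite_prox Uu0 (apg_s_scalar t) A0 mu0 L0.
move=> /[dup] mub; rewrite Hw => ubw; rewrite ubw in mub *; split=> // v Uv.
have W0 : 0 < W t by rewrite addr_gt0 // mulr_gt0.
pose l v := apg_s theta G t v + - L * 'd omr u0 v.
have ll : scalar l by exact/scalarD/scalarZ/scalar_diff/apg_s_scalar.
pose H v := l v + A t * zr v.
have cH : convex_on U H.
  move=> x y s Ux Uy s01.
  have := ps_zeta_convex PS Ux Uy s01; rewrite -(ler_pM2l A0).
  rewrite /H (scalar_comb _ _ _ _ ll) /zr /=; lra.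
pose K := \sum_(0 <= i < t.+1) alpha i * e i + L * ('d omr u0 u0 - omr u0).
have E x : apg_estimate e u0 t x = H x + W t * omr x + K.
  rewrite /apg_estimate (eq_bigr _ (fun i _ => mulrDr _ _ _)) big_split /=.
  by rewrite -apg_sE breg_expand /H /l /K /W; ring.
rewrite !E.
have := three_point PS cH W0 Uow _ Uv; rewrite -/omr => tp.
suff : H w + W t * omr w + W t * breg omr v w <= H v + W t * omr v by lra.
apply: tp => x Ux.
have [_ mw] := mub; have := mw x Ux; rewrite !breg_expand /H /l /W; lra.
Qed.

(** By induction on [t].  The growth of the estimate function around its
    minimiser [apg_ubar] leaves a Bregman term, which the choice of [apg_w] keeps
    under control; since [apg_z - apg_u] is [apg_tau] times [apg_w - apg_ubar],
    that term dominates the quadratic gap between the model and [h] by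
    [apg_alpha_sqr_le].  Each step adds one error [delta], weighted by [A]. *)
Lemma apg_estimate_bound n tr (h : V -> R) (e : nat -> R) (delta : R) :
  is_apg U om zeta mu L G n tr ->
  (forall t v, (t <= n)%N -> U v -> e t + G t v <= h v) ->
  (forall t v, (t <= n)%N -> U v ->
     h v <= e t + G t v + L / 2 * `|v - apg_u tr t| ^+ 2 + delta) ->
  forall t, (t <= n)%N -> forall v, U v ->
  A t * (h (apg_z tr t) + zr (apg_z tr t) + mu * omr (apg_z tr t))
  <= apg_estimate e (apg_u tr 0) t v + delta * \sum_(0 <= i < t.+1) A i.
Proof.
move=> apg lo up; have feas := apg_feasible apg.
have [Uou0 m0 H] := apg; have [Uu0 _] := Uou0.
elim=> [_ v Uv|t IH tn v Uv].
  move: m0.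
  have Eo x : ((apg_s theta G 0 x)%:E + zeta x + mu%:E * om x
      + L%:E * bregman om x (apg_u tr 0)
    = (apg_s theta G 0 x)%:E + 1%:E * (zeta x + mu%:E * om x)
      + L%:E * bregman om x (apg_u tr 0))%E by rewrite mul1e addeA.
  move=> [Uz mz].
  have := mz v Uv; rewrite !Eo !estimate_objE // lee_fin /= => mzv.
  have := up 0%N _ (leq0n _) Uz; have := breg_ge PS Uou0 Uz; rewrite -/omr.
  rewrite -(ler_pM2l L0) /apg_estimate /A /apg_A !big_nat1 /=; lra.
have [Uut1 Uzt1] := feas _ tn; have [Uut Uzt] := feas _ (ltnW tn).
have [mub uE [Uw mw] zE] := H t tn.
have [Uub _] := mub.
have [Uoub gr] := estimate_growth e Uu0 mub.
set z := apg_z tr t in IH zE uE Uzt *; set z' := apg_z tr t.+1 in zE Uzt1 *.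
set u := apg_u tr t.+1 in uE Uut1 *; set w := apg_w tr t.+1 in Uw mw zE *.
set ub := apg_ubar tr t.+1 in mub uE mw Uub Uoub gr *.
set u0 := apg_u tr 0 in IH mub gr *.
have A0 : 0 < A t := apg_A_gt0 _ _.
have A1 : 0 < A t.+1 := apg_A_gt0 _ _.
have AS : A t.+1 = A t + alpha t.+1 := apg_AS _ _.
have al0 : 0 <= alpha t.+1 := apg_alpha_ge0 _ _.
pose chi x := zr x + mu * omr x.
pose ell x := e t.+1 + G t.+1 x.
have bS (F : nat -> R) :
    \sum_(0 <= i < t.+2) F i = \sum_(0 <= i < t.+1) F i + F t.+1.
  by rewrite big_nat_recr.
have ES x : apg_estimate e u0 t.+1 x = apg_estimate e u0 t x + alpha t.+1 * (ell x + chi x).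
  by rewrite /apg_estimate bS AS /ell /chi; ring.
have mwv : alpha t.+1 * (ell w + chi w) + W t * breg omr w ub
    <= alpha t.+1 * (ell v + chi v) + W t * breg omr v ub.
  have Eo x : U x -> ((alpha t.+1)%:E * ((G t.+1 x)%:E + zeta x + mu%:E * om x)
      + (A t * mu + L)%:E * bregman om x ub
    = (alpha t.+1 * (G t.+1 x + zr x + mu * omr x) + W t * breg omr x ub)%:E)%E.
    by move=> Ux; rewrite (bregmanE PS) // (ps_om_fin PS Ux) (ps_zeta_fin PS Ux).
  have := mw v Uv; rewrite !Eo // lee_fin /ell /chi; lra.
have IHub := IH (ltnW tn) _ Uub; have grv := gr _ Uv.
have bw := breg_ge PS Uoub Uw; rewrite -/omr in bw.
have tau01 := apg_tau_itv theta t; rewrite -/(A _) in tau01.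
pose tau := alpha t.+1 / A t.+1; have tauA : tau * A t.+1 = alpha t.+1.
  by rewrite /tau divfK // gt_eqF.
have At : A t = (1 - tau) * A t.+1 by rewrite mulrBl tauA AS; ring.
have zE' : z' = tau *: w + (1 - tau) *: z by rewrite zE addrC.
have chic : A t.+1 * chi z' <= A t * chi z + alpha t.+1 * chi w.
  have zc : zr z' <= tau * zr w + (1 - tau) * zr z.
    by rewrite zE'; exact: (ps_zeta_convex PS Uw Uzt tau01).
  have oc : omr z' <= tau * omr w + (1 - tau) * omr z.
    by rewrite zE'; exact: (om_convex_on PS Uw Uzt tau01).
  rewrite At -tauA; have := ler_wpM2l (ltW A1) (lerD zc (ler_wpM2l (ltW mu0) oc)).
  rewrite /chi; move=> /le_trans; apply; rewrite le_eqVlt; apply/orP; left; apply/eqP; ring.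
have lo_z := lo _ z tn Uzt; have up_z' := up _ _ tn Uzt1.
have ellc : A t.+1 * ell z' = A t * ell z + alpha t.+1 * ell w.
  by rewrite /ell zE' (scalar_comb _ _ _ _ (Glin _)) At -tauA; ring.
have quad : A t.+1 * (L / 2 * `|z' - u| ^+ 2) <= W t * (`|w - ub| ^+ 2 / 2).
  have -> : z' - u = tau *: (w - ub).
    by rewrite zE uE -/tau scalerBr opprD addrACA subrr add0r.
  rewrite normrZ exprMn.
  have tau0 : 0 <= tau by have /andP[] := tau01.
  rewrite (ger0_norm tau0).
  have -> : A t.+1 * (L / 2 * (tau ^+ 2 * `|w - ub| ^+ 2))
     = (A t.+1 * L * tau ^+ 2) * (`|w - ub| ^+ 2 / 2) by ring.
  apply: ler_wpM2r; first by rewrite divr_ge0 ?exprn_ge0.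
  have th0 : 0 <= theta by rewrite divr_ge0 ?ltW.
  have : alpha t.+1 ^+ 2 <= (A t * theta + 1) * A t.+1 := apg_alpha_sqr_le t th0.
  rewrite -tauA => wt.
  have -> : W t = (A t * theta + 1) * L by rewrite /W /theta; field; rewrite gt_eqF.
  rewrite -(ler_pM2r A1); have := ler_wpM2r (ltW L0) wt.
  have -> : (tau * A t.+1) ^+ 2 * L = A t.+1 * L * tau ^+ 2 * A t.+1 by ring.
  by have -> : (A t * theta + 1) * A t.+1 * L = (A t * theta + 1) * L * A t.+1 by ring.
have bw' : W t * (`|w - ub| ^+ 2 / 2) <= W t * breg omr w ub.
  by rewrite ler_pM2l // addr_gt0 // mulr_gt0.
have := up_z'; rewrite -/u -/(ell _) -(ler_pM2l A1) => up2.
have := lo_z; rewrite -/(ell _) -(ler_pM2l A0) => lo2.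
rewrite bS ES -[h z' + zr z' + _]addrA -/(chi z').
have IH' : A t * (h z + chi z) <= apg_estimate e u0 t ub + delta * \sum_(0 <= i < t.+1) A i.
  by rewrite /chi addrA.
clearbody chi ell z z' u w ub.
move: up2 lo2 IH' mwv chic ellc quad bw' grv.
move: (breg _ w ub) (breg _ v ub) => b1 b2.
by rewrite !mulrDr; clear; lra.
Qed.

End EstimateSequence.

(** * Existence of solver runs *)

Section TraceExistence.
Context {R : realType} {V : normedModType R}.
Variables (U : set V) (zeta om : V -> \bar R).
Hypothesis PS : prox_setup U zeta om.
Variables (mu L : R) (Gf : nat -> V -> V -> R) (u0 : V).
Hypotheses (mu0 : 0 < mu) (L0 : 0 < L) (Glin : forall t u, scalar (Gf t u)).
Hypothesis Uou0 : dgf_interior U om u0.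

Let Uo := dgf_interior U om.
Let theta := mu / L.
Let alpha := apg_alpha theta.
Let A := apg_A theta.

Let pick (F : V -> \bar R) : V := xget 0 (argmin_on U F).

Lemma prox_pick (u : V) (Fe : V -> \bar R) (l : V -> R) (a b c : R) :
  U u -> scalar l -> 0 < a -> 0 < b -> 0 < c ->
  (forall v, U v -> Fe v = (l v + a * ((fine \o zeta) v + b * (fine \o om) v)
     + c * breg (fine \o om) v u)%:E) ->
  argmin_on U Fe (pick Fe) /\ Uo (pick Fe).
Proof.
move=> Uu ll a0 b0 c0 E.
have [w Uow Hw] := composite_prox PS Uu ll a0 b0 c0.
have mw : argmin_on U Fe w by rewrite (argmin_onE _ E) Hw.
have mp : argmin_on U Fe (pick Fe) by exact: xgetI mw.
by split=> //; move: mp; rewrite (argmin_onE _ E) Hw => ->.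
Qed.

(** The data carried by the recursion; the gradient at step [t] depends on the
    query point of step [t], hence the trace cannot be defined pointwise. *)
Record apg_state := ApgState {
  st_s : V -> R; st_u : V; st_z : V; st_ubar : V; st_w : V }.

Let ubar_obj t (s : V -> R) v : \bar R :=
  ((s v)%:E + (A t)%:E * (zeta v + mu%:E * om v) + L%:E * bregman om v u0)%E.
Let w_obj t (g : V -> R) ub v : \bar R :=
  ((alpha t.+1)%:E * ((g v)%:E + zeta v + mu%:E * om v)
   + (A t * mu + L)%:E * bregman om v ub)%E.

Let apg_step t (st : apg_state) : apg_state :=
  let ub := pick (ubar_obj t (st_s st)) in
  let tau := apg_tau theta t.+1 in
  let u := (1 - tau) *: st_z st + tau *: ub in
  let w := pick (w_obj t (Gf t.+1 u) ub) in
  ApgState (fun v => st_s st v + alpha t.+1 * Gf t.+1 u v) u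
    ((1 - tau) *: st_z st + tau *: w) ub w.

Let apg_states : nat -> apg_state :=
  fix states t := if t is t'.+1 then apg_step t' (states t') else
    ApgState (Gf 0 u0) u0
      (pick (fun v => (Gf 0 u0 v)%:E + zeta v + mu%:E * om v
                      + L%:E * bregman om v u0)%E) u0 u0.

Lemma apg_exists : exists tr : apg_trace V, apg_u tr 0 = u0 /\
  forall n, is_apg U om zeta mu L (fun t => Gf t (apg_u tr t)) n tr.
Proof.
pose tr := ApgTrace (st_u \o apg_states) (st_z \o apg_states)
  (st_ubar \o apg_states) (st_w \o apg_states).
exists tr; split=> // n.
have sE t : apg_s theta (fun t => Gf t (apg_u tr t)) t = st_s (apg_states t).
  by elim: t => //= t ->.
have slin t : scalar (st_s (apg_states t)).
  elim: t => [|t IH]; first exact: Glin.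
  exact: scalarD IH (scalarZ _ (Glin _ _)).
have Uu0 : U u0 by have [] := Uou0.
have A0 t : 0 < A t := apg_A_gt0 _ _.
have th0 : 0 < theta by rewrite divr_gt0.
have ub t : argmin_on U (ubar_obj t (st_s (apg_states t)))
    (st_ubar (apg_states t.+1)) /\ Uo (st_ubar (apg_states t.+1)).
  apply: (prox_pick Uu0 (slin t) (A0 t) mu0 L0) => v Uv.
  exact: (estimate_objE PS).
split=> //.
- apply: (prox_pick Uu0 (Glin 0%N u0) ltr01 mu0 L0 _).1 => v Uv.
  by rewrite -(estimate_objE PS) // mul1e addeA.
- move=> t _; rewrite sE; have [mub [Uub _]] := ub t; split=> //.
  have W0 : 0 < A t * mu + L by rewrite addr_gt0 // mulr_gt0.
  apply: (prox_pick Uub (scalarZ (alpha t.+1)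
    (Glin t.+1 (st_u (apg_states t.+1)))) (apg_alpha_gt0 _ th0) mu0 W0 _).1 => v Uv.
  rewrite (bregmanE PS) // (ps_om_fin PS Uv) (ps_zeta_fin PS Uv).
  have R4 (a x y z : R) : a * (x + y + z) = a * x + a * (y + z) by ring.
  by rewrite -[LHS]/(_%:E) R4.
Qed.

End TraceExistence.

(** * Convexity and smoothness of the subproblem *)

Section ProblemFacts.
Context {R : realType} {X Y : normedModType R}.
Variable P : problem X Y.
Hypothesis ok : problem_ok P.

Let D := domX P.
Let FY := feasY P.
Let rr : X -> R := fine \o reg P.
Let wX : X -> R := fine \o omX P.
Let wY : Y -> R := fine \o omY P.

Lemma reg_fin x : D x -> reg P x = (fine (reg P x))%:E.
Proof.
by move=> Dx; rewrite fineK // fin_numElt Dx ltNye andbT; apply/eqP/(reg_proper ok).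
Qed.

Lemma omX_fin x : D x -> omX P x = (fine (omX P x))%:E.
Proof.
move=> Dx; have /interior_subset/= := domX_sub_omX ok Dx; rewrite /edom /= => h.
by rewrite fineK // fin_numElt h ltNye andbT; apply/eqP/(dgf_proper (omX_dgf ok)).
Qed.

Lemma omY_le_RYe y : FY y -> (`|omY P y| <= RYe P)%E.
Proof. by move=> Fy; apply: ereal_sup_ubound; exists y. Qed.

Lemma omY_fin y : FY y -> omY P y = (fine (omY P y))%:E.
Proof.
move=> Fy; rewrite fineK // fin_num_abs.
exact: le_lt_trans (omY_le_RYe Fy) (RY_fin ok).
Qed.

Lemma RY_pos : 0 < RY P.
Proof. by apply: fine_gt0; rewrite (RY_gt0 ok) (RY_fin ok). Qed.

Lemma omY_bound y : FY y -> `|wY y| <= RY P.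
Proof.
move=> Fy; have := omY_le_RYe Fy; rewrite (omY_fin Fy) /=.
rewrite -[RYe P]fineK ?lee_fin // fin_numElt (RY_fin ok) andbT.
exact: lt_trans (RY_gt0 ok).
Qed.

Lemma prox_setup_X : prox_setup D (reg P) (omX P).
Proof.
have cv u v s : D u -> D v -> 0 <= s <= 1 -> D (s *: u + (1 - s) *: v).
  move=> Du Dv s01; apply: le_lt_trans (reg_convex ok _ _ s01) _.
  by rewrite (reg_fin Du) (reg_fin Dv) -!EFinM -EFinD ltry.
split=> //.
- exact: omX_fin.
- exact: reg_fin.
- exact: dgf_strongly_convex (omX_dgf ok).
- move=> u v s Du Dv s01; have := reg_convex ok u v s01.
  rewrite (reg_fin Du) (reg_fin Dv) (reg_fin (cv _ _ _ Du Dv s01)).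
  by rewrite -!EFinM -EFinD lee_fin.
- exact: (dgf_C1 (omX_dgf ok)).1.
- exact: prox_X ok.
Qed.

Lemma convex_functionW (E : normedModType R) (U : set E) (f : E -> R) :
  convex_function U f -> convex_on U f.
Proof.
move=> cf u v s Uu Uv /andP[s0 s1].
have := cf (Itv01 s0 s1) u v; rewrite !inE => /(_ Uu Uv).
by [].
Qed.

Lemma prox_setup_Y : prox_setup FY (EFin \o gY P) (omY P).
Proof.
split=> //.
- move=> u v s Fu Fv /andP[s0 s1].
  have := feasY_convex ok (Itv01 s0 s1) (x := u) (y := v).
  by rewrite !inE; apply.
- exact: omY_fin.
- exact: dgf_strongly_convex (omY_dgf ok).
- exact: convex_functionW (gY_convex ok).
- exact: (dgf_C1 (omY_dgf ok)).1.
- exact: prox_Y ok.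
Qed.

Lemma omX_diff x : D x -> differentiable wX x.
Proof. by move=> Dx; apply: (ps_diff prox_setup_X); exact: domX_sub_omX ok _ Dx. Qed.

Lemma Phi_x_diff x y : D x -> FY y -> differentiable (Phi P ^~ y) x.
Proof. by move=> Dx Fy; apply: (Phi_diff_x ok) Fy; exact: openX_sub ok _ Dx. Qed.

Lemma Phi_y_diff x y : D x -> FY y -> differentiable (Phi P x) y.
Proof. by move=> Dx Fy; apply: (Phi_diff_y ok) Dx _; exact: openY_sub ok _ Fy. Qed.

Lemma Phi_y_upper x y y' : D x -> FY y -> FY y' ->
  Phi P x y' <= Phi P x y + 'd (Phi P x) y (y' - y).
Proof.
move=> Dx Fy Fy'; rewrite -lerBlDl; apply: diff_dir_ge; first exact: Phi_y_diff.
move=> s /andP[s0 s1]; have s01 : 0 <= s <= 1 by rewrite ltW.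
have := convex_functionW (Phi_concave ok Dx) Fy' Fy s01.
rewrite convex_comb_shift /=; lra.
Qed.

Lemma segment_mem (E : normedModType R) (U : set E) zeta om (u d : E) (s : R) :
  prox_setup U zeta om -> U u -> U (u + d) -> 0 <= s <= 1 -> U (u + s *: d).
Proof.
move=> PS Uu Ud s01; have := ps_convex PS Ud Uu s01.
by rewrite scalerDr addrAC -scalerDl addrC addrCA subrr addr0 scale1r addrC.
Qed.

Lemma Phi_y_lower x y y' : D x -> FY y -> FY y' ->
  Phi P x y + 'd (Phi P x) y (y' - y) - Lyy P / 2 * `|y' - y| ^+ 2 <= Phi P x y'.
Proof.
move=> Dx Fy Fy'; set d := y' - y.
have y'E : y' = y + d by rewrite addrC subrK.
have Fs s : 0 <= s <= 1 -> FY (y + s *: d).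
  by move=> s01; apply: (segment_mem prox_setup_Y) => //; rewrite -y'E.
rewrite y'E mulrAC; apply: descent_lemma_lower => s s01.
  by apply: Phi_y_diff => //; exact: Fs.
have dys := Phi_y_diff Dx (Fs s s01); have dy := Phi_y_diff Dx Fy.
apply: le_trans (le_dual_diffB d dy dys) _.
have := grad_y_lip_y ok Dx Fy (Fs s s01).
rewrite opprD addrA subrr sub0r normrN normrZ ger0_norm; last by have /andP[] := s01.
move=> /(ler_wpM2r (normr_ge0 d)); congr (_ <= _); ring.
Qed.

Section Subproblem.
Variables (lam : R) (xk : X).
Hypotheses (mu0 : 0 < mu_of P lam) (Dxk : D xk).

Let mu := mu_of P lam.

Lemma Psi_diff x y : D x -> FY y -> is_diff x (Psi P lam xk ^~ y)
  (gamma P *: ('d wX x : X -> R) - lam^-1 *: ('d wX xk : X -> R)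
   + 'd (Phi P ^~ y) x).
Proof.
move=> Dx Fy.
have h1 : is_diff x wX ('d wX x) by apply: DiffDef => //; exact: omX_diff.
have ck : continuous ('d wX xk) by apply: diff_continuous; exact: omX_diff.
have h2 : is_diff x ('d wX xk) ('d wX xk).
  by apply: DiffDef; [exact: linear_differentiable|exact: diff_lin].
have h3 : is_diff x (Phi P ^~ y) ('d (Phi P ^~ y) x).
  by apply: DiffDef => //; exact: Phi_x_diff.
exact: is_diffD (is_diffB (is_diffZ (gamma P) h1) (is_diffZ lam^-1 h2)) h3.
Qed.

Lemma Psi_diffE x y v : D x -> FY y -> 'd (Psi P lam xk ^~ y) x v
  = gamma P * 'd wX x v - lam^-1 * 'd wX xk v + 'd (Phi P ^~ y) x v.
Proof. by move=> Dx Fy; have h := Psi_diff Dx Fy; rewrite (diff_val (is_diff_def := h)). Qed.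

(** The weak convexity of [Phi ^~ y] is compensated by the term
    [gamma * omX]. *)
Lemma Psi_grad_lower x x' y : D x -> D x' -> FY y ->
  Psi P lam xk x y + 'd (Psi P lam xk ^~ y) x (x' - x) <= Psi P lam xk x' y.
Proof.
move=> Dx Dx' Fy; rewrite Psi_diffE // [X in lam^-1 * X]linearB /= /Psi.
have := weakly_convex ok Dx Dx' Fy.
have Uo : dgf_interior D (omX P) x by split=> //; exact: domX_sub_omX ok _ Dx.
have := ler_wpM2l (ltW (gamma_gt0 ok)) (breg_ge prox_setup_X Uo Dx').
rewrite /breg -/wX -![fine (omX P _)]/(wX _).
move: (wX x) (wX x') ('d wX x _) ('d wX xk x) ('d wX xk x').
move: ('d (Phi P ^~ y) x _) => e a b c d d'.
by lra.
Qed.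

Lemma Psi_grad_upper x x' y : D x -> D x' -> FY y ->
  Psi P lam xk x' y <= Psi P lam xk x y + 'd (Psi P lam xk ^~ y) x (x' - x)
    + Lxx' P / 2 * `|x' - x| ^+ 2.
Proof.
move=> Dx Dx' Fy; set d := x' - x.
have x'E : x' = x + d by rewrite addrC subrK.
have Ds s : 0 <= s <= 1 -> D (x + s *: d).
  by move=> s01; apply: (segment_mem prox_setup_X) => //; rewrite -x'E.
rewrite x'E mulrAC; apply: descent_lemma => s s01.
  by have h := Psi_diff (Ds s s01) Fy; exact: ex_diff.
have Dxs := Ds s s01; rewrite !Psi_diffE //.
have h1 := le_dual_diffB d (omX_diff Dxs) (omX_diff Dx).
have h2 := le_dual_diffB d (Phi_x_diff Dxs Fy) (Phi_x_diff Dx Fy).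
have := ler_wpM2r (normr_ge0 d) (omX_lip ok Dxs Dx).
have := ler_wpM2r (normr_ge0 d) (grad_x_lip_x ok Dxs Dx Fy).
have -> : x + s *: d - x = s *: d by rewrite addrC addKr.
have /andP[s0 _] := s01; rewrite normrZ ger0_norm // => l2 l1.
have := ler_wpM2l (ltW (gamma_gt0 ok)) (le_trans h1 l1).
have := le_trans h2 l2; rewrite /Lxx' -/wX {h1 h2 l1 l2 s0 x'E}.
move: ('d wX xk d) ('d wX (x + s *: d) d) ('d wX x d) (`|d|)
  ('d (Phi P ^~ y) (x + s *: d) d) ('d (Phi P ^~ y) x d) => a b c n e f.
by lra.
Qed.

Definition inner_obj x y : R := Psi P lam xk x y + rr x + mu * wX x.

Lemma psiP_inner_obj x y : D x -> psiP P lam xk x y = (inner_obj x y)%:E.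
Proof. by move=> Dx; rewrite /psiP (reg_fin Dx) (omX_fin Dx). Qed.

Lemma inner_obj_convex y u v s : FY y -> D u -> D v -> 0 <= s <= 1 ->
  inner_obj (s *: u + (1 - s) *: v) y + mu * (s * (1 - s) / 2 * `|u - v| ^+ 2)
    <= s * inner_obj u y + (1 - s) * inner_obj v y.
Proof.
move=> Fy Du Dv s01; set x := s *: u + _.
have Dx : D x by exact: (ps_convex prox_setup_X).
have /andP[s0 s1] := s01; have s1' : 0 <= 1 - s by rewrite subr_ge0.
have hu := ler_wpM2l s0 (Psi_grad_lower Dx Du Fy).
have hv := ler_wpM2l s1' (Psi_grad_lower Dx Dv Fy).
have hr := ps_zeta_convex prox_setup_X Du Dv s01.
have hw := ler_wpM2l (ltW mu0) (om_convex prox_setup_X Du Dv s01).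
have h0 : s * 'd (Psi P lam xk ^~ y) x (u - x)
    + (1 - s) * 'd (Psi P lam xk ^~ y) x (v - x) = 0.
  rewrite -(scalar_comb _ _ _ _ (scalar_diff _ _)).
  rewrite !scalerBr addrACA -opprD -scalerDl -/x [s + _]addrC subrK scale1r.
  by rewrite subrr linear0.
rewrite -/x -/wX in hw; rewrite -/x in hr.
rewrite /inner_obj -/x; move: hu hv hr hw h0; rewrite -/rr -/mu.
move: ('d _ x _) ('d _ x _) (rr _) (rr _) (rr _) (wX _) (wX _) (wX _).
move: (Psi _ _ _ _ _) (Psi _ _ _ _ _) (Psi _ _ _ _ _) (`|_|).
move=> n1 n2 n3 n4 n5 n6 n7 n8 n9 n10 n11 n12.
move: mu => m; clear s0 s1 s1' s01; lra.
Qed.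

End Subproblem.
End ProblemFacts.

(** * Minimisers of the subproblem and of the proximal problem *)

(** Minimality along the segment from [xs] to [x], divided by the step and with
    the step tending to 0. *)
Lemma strong_growth (R : realType) (V : normedModType R) (U : set V)
    (F : V -> R) (m : R) (xs x : V) :
  (forall s, 0 <= s <= 1 -> U (s *: x + (1 - s) *: xs) /\
    F (s *: x + (1 - s) *: xs) + m * (s * (1 - s) / 2 * `|x - xs| ^+ 2)
      <= s * F x + (1 - s) * F xs) ->
  (forall v, U v -> F xs <= F v) ->
  F xs + m / 2 * `|x - xs| ^+ 2 <= F x.
Proof.
move=> sc mn; set n := `|x - xs| ^+ 2; set k := m / 2 * n.
have key s : 0 < s <= 1 -> (1 - s) * k <= F x - F xs.
  move=> /andP[s0 s1]; have [] := sc s; first by rewrite ltW.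
  move=> /mn h1; rewrite -/n => h2; have h3 := le_trans (lerD h1 (lexx _)) h2.
  rewrite -(ler_pM2l s0) /k; lra.
rewrite -lerBrDl; move: key; move: (F x - F xs) k => c k key.
have c0 : 0 <= c by have := key 1; rewrite subrr mul0r; apply; rewrite ltr01 lexx.
rewrite leNgt; apply/negP => ck; have k0 : 0 < k := le_lt_trans c0 ck.
have := key ((k - c) / (2 * k)).
have -> : (1 - (k - c) / (2 * k)) * k = (k + c) / 2 by field; rewrite gt_eqF.
move=> h; have := h _; rewrite divr_gt0 ?subr_gt0 ?mulr_gt0 //.
rewrite ler_pdivrMr ?mulr_gt0 // => /(_ _); lra.
Qed.

Section Minimizers.
Context {R : realType} {X Y : normedModType R}.
Variable P : problem X Y.
Hypothesis ok : problem_ok P.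
Hypothesis fX : finite_dimensional X.

Let D := domX P.
Let FY := feasY P.
Let rr : X -> R := fine \o reg P.
Let wX : X -> R := fine \o omX P.
Let wY : Y -> R := fine \o omY P.

(** All the objectives below are a continuous function plus the lower
    semicontinuous [reg]. *)
Lemma closed_reg_sublevel (a : X -> R) (c : R) :
  (forall x, D x -> {for x, continuous a}) ->
  closed [set x | D x /\ a x + rr x <= c].
Proof.
move=> ca x clx.
have Dx : D x.
  apply: (domX_closed ok); apply: closure_subset clx => z [] //.
split=> //; rewrite leNgt; apply/negP => lt.
pose e := (a x + rr x - c) / 2; have e0 : 0 < e by rewrite divr_gt0 // subr_gt0.
have [|V Vx HV] := @reg_closed _ _ _ _ ok x (rr x - e).
  by rewrite (reg_fin ok Dx) lte_fin -[fine _]/(rr x) ltrBlDr ltrDl.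
have Wx : nbhs x [set z | `|a x - a z| < e].
  by have /cvgrPdist_lt := ca x Dx; exact.
have [z [[Dz az] [Vz Wz]]] := clx _ (filterI Vx Wx).
have := HV z Vz; rewrite (reg_fin ok Dz) lte_fin -[fine _]/(rr z) => rz.
move: Wz => /=; rewrite ltr_distlC => /andP[]; rewrite /e in rz *; move: az rz; lra.
Qed.

Lemma Phi_bounded_above x : D x -> exists M, forall y, FY y -> Phi P x y <= M.
Proof.
move=> Dx; have [|y0 _ Hy] := compact_EVT_max (f := Phi P x) (feasY_nonempty ok)
  (feasY_compact ok).
  apply: continuous_in_subspaceT => y; rewrite inE => Fy.
  exact/differentiable_continuous/(Phi_y_diff ok).
by exists (Phi P x y0) => y Fy; apply: Hy; rewrite inE.
Qed.

Lemma gY_bounded_below : exists m, forall y, FY y -> m <= gY P y.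
Proof.
have [y0 _ Hy] := compact_EVT_min (feasY_nonempty ok) (feasY_compact ok)
  (gY_continuous ok).
by exists (gY P y0) => y Fy; apply: Hy; rewrite inE.
Qed.

Lemma breg_omY_bounded y0 : dgf_interior FY (omY P) y0 ->
  exists B, forall y, FY y -> breg wY y y0 <= B.
Proof.
move=> [Fy0 iy0]; have [M HM] := diff_bounded (ps_diff (prox_setup_Y ok) iy0).
have [N [_ HN]] := compact_bounded (feasY_compact ok).
have HN1 := HN (N + 1) ltac:(by rewrite ltrDl).
exists (2 * RY P + `|M| * (N + 1 + (N + 1))) => y Fy.
have := HM (y - y0); have := omY_bound ok Fy; have := omY_bound ok Fy0.
rewrite !ler_norml => /andP[a1 a2] /andP[b1 b2] /andP[h1 _].
have n1 : `|y - y0| <= N + 1 + (N + 1).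
  by apply: le_trans (ler_normB _ _) _; apply: lerD; exact: HN1.
have h2 : M * `|y - y0| <= `|M| * (N + 1 + (N + 1)).
  apply: le_trans (ler_wpM2l (normr_ge0 M) n1).
  by apply: ler_wpM2r => //; exact: ler_norm.
rewrite /breg -/wY in h1 *; rewrite -/wY in a1 a2 b1 b2.
by move: a1 a2 b1 b2 h1 h2 => {n1}; move: ('d _ _ _) (_ * _) (_ * _) (wY y) (wY y0) => a b c d e; lra.
Qed.

Section SubproblemMinimizers.
Variables (lam : R) (xk : X).
Hypotheses (lam0 : 0 < lam) (mu0 : 0 < mu_of P lam) (Dxk : D xk).
Let mu := mu_of P lam.
Let ph := inner_obj P lam xk.

Lemma inner_obj_closed_sublevel y c : FY y -> closed [set x | D x /\ ph x y <= c].
Proof.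
move=> Fy.
have -> : [set x | D x /\ ph x y <= c]
    = [set x | D x /\ (Psi P lam xk ^~ y + mu *: wX) x + rr x <= c].
  by apply/seteqP; split=> x /= [Dx h]; split=> //; move: h;
    rewrite /ph /inner_obj fctE /= -/mu [X in _ -> is_true (X <= _)]addrAC.
apply: closed_reg_sublevel => x Dx; apply: differentiable_continuous.
have h := Psi_diff ok lam Dxk Dx Fy.
apply: differentiableD; first exact: ex_diff.
apply: differentiableZ; exact: (omX_diff ok).
Qed.

(** The tangent of [Psi ^~ y] at a point bounds the objective below by that of a
    proximal problem, which is solvable. *)
Lemma inner_obj_bounded_below y : FY y -> exists b, forall x, D x -> b <= ph x y.
Proof.
move=> Fy; have [x0 Dx0] := domX_nonempty ok.
have [w Uow Hw] := prox_exists (prox_setup_X ok) 0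
  (scalar_diff (Psi P lam xk ^~ y) x0) ltr01 mu0.
have [_ mw] := (Hw w).2 erefl.
pose l := 'd (Psi P lam xk ^~ y) x0.
exists (Psi P lam xk x0 y - l x0 + (l w + rr w + mu * wX w)) => x Dx.
have h1 := Psi_grad_lower ok lam Dxk Dx0 Dx Fy; rewrite linearB /= -/l in h1.
have h2 := mw x Dx; rewrite -/l -/rr -/wX -/mu !mul1r !add0r in h2.
rewrite /ph /inner_obj -/rr -/wX -/mu.
move: h1 h2; move: (l x) (l x0) (l w) (rr x) (rr w) (wX x) (wX w) mu.
by move=> *; lra.
Qed.

Lemma inner_obj_minimizer y : FY y -> exists2 xs, D xs &
  forall x, D x -> ph xs y + mu / 2 * `|x - xs| ^+ 2 <= ph x y.
Proof.
move=> Fy; have cv := ps_convex (prox_setup_X ok).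
have sc := inner_obj_convex ok mu0 Dxk Fy.
have h12 : 0 <= (2^-1 : R) <= 1 by rewrite invr_ge0 ler0n invf_le1 // ler1n.
have [|||||xs Dxs mxs] := @strongly_convex_minimizer _ _ D (ph ^~ y) (mu / 8) fX.
- by rewrite divr_gt0.
- exact: domX_nonempty ok.
- move=> u v Du Dv.
  have -> : 2^-1 *: u + 2^-1 *: v = 2^-1 *: u + (1 - 2^-1) *: v.
    by congr (_ + _ *: _); field.
  split; first exact: cv.
  by have := sc _ _ _ Du Dv h12; rewrite -/ph -/mu; lra.
- exact: inner_obj_bounded_below.
- by move=> c; exact: inner_obj_closed_sublevel.
exists xs => // x Dx.
apply: (strong_growth (U := D) (F := ph ^~ y)) => [s s01|//].
by split; [exact: cv|exact: sc].
Qed.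

Lemma inner_obj_argmin y : FY y ->
  exists2 xs, D xs & forall x, D x -> ph xs y <= ph x y.
Proof.
move=> Fy; have [xs Dxs mxs] := inner_obj_minimizer Fy; exists xs => // x Dx.
apply: le_trans (mxs x Dx); rewrite lerDl.
by rewrite mulr_ge0 ?exprn_ge0 // divr_ge0 // ltW.
Qed.

(** With [p] equal to [gY] this is [q_obj], and with a multiple of [omY] added to
    it the smoothed objective; both are handled together. *)
Definition pen_obj (p : Y -> R) (x : X) : R :=
  sup [set Phi P x y - p y | y in FY] + rr x.

Definition pen_prox_obj (p : Y -> R) (x : X) : R := pen_obj p x + lam^-1 * breg wX x xk.

Definition penalty (p : Y -> R) : Prop := exists m, forall y, FY y -> m <= p y.

Lemma penalized_ubound p x : penalty p -> D x ->
  has_ubound [set Phi P x y - p y | y in FY].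
Proof.
move=> [m Hm] Dx; have [M HM] := Phi_bounded_above Dx.
exists (M - m) => _ [y Fy <-]; have := HM y Fy; have := Hm y Fy; lra.
Qed.

Lemma penalized_nonempty p x : [set Phi P x y - p y | y in FY] !=set0.
Proof. by have [y Fy] := feasY_nonempty ok; exists (Phi P x y - p y), y. Qed.

Lemma pen_obj_leP p x c : penalty p -> D x ->
  pen_obj p x <= c <-> forall y, FY y -> Phi P x y - p y + rr x <= c.
Proof.
move=> pp Dx; rewrite -lerBrDr; split=> [h y Fy|h].
  rewrite -lerBrDr; apply: le_trans h; apply: sup_ubound; last by exists y.
  exact: penalized_ubound.
apply: sup_le_ub; first exact: penalized_nonempty.
by move=> _ [y Fy <-]; rewrite lerBrDr; exact: h.
Qed.

(** The constant by which [inner_obj] differs from the proximal objective of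
    [Phi ^~ y + reg]. *)
Let k0 : R := lam^-1 * ('d wX xk xk - wX xk).

Lemma inner_obj_bregE x y : ph x y + k0 = Phi P x y + rr x + lam^-1 * breg wX x xk.
Proof.
rewrite /ph /inner_obj /Psi /k0 breg_expand /mu_of -/rr -/wX -[fine _]/(wX x).
by move: ('d wX xk x) ('d wX xk xk) (rr x) (wX x) (wX xk) => *; ring.
Qed.

Lemma pen_prox_obj_leP p x c : penalty p -> D x ->
  pen_prox_obj p x <= c <-> forall y, FY y -> ph x y - p y + k0 <= c.
Proof.
move=> pp Dx; rewrite /pen_prox_obj -lerBrDr (pen_obj_leP _ pp Dx).
by split=> h y Fy; move: (h y Fy) (inner_obj_bregE x y);
  move: (ph x y) (Phi P x y) (p y) (rr x) (_ * _) k0 => *; lra.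
Qed.

Lemma pen_prox_obj_convex p u v s : penalty p -> D u -> D v -> 0 <= s <= 1 ->
  pen_prox_obj p (s *: u + (1 - s) *: v) + mu * (s * (1 - s) / 2 * `|u - v| ^+ 2)
    <= s * pen_prox_obj p u + (1 - s) * pen_prox_obj p v.
Proof.
move=> pp Du Dv s01; rewrite -lerBrDr pen_prox_obj_leP //; last exact: (ps_convex (prox_setup_X ok)).
move=> y Fy; have := inner_obj_convex ok mu0 Dxk Fy Du Dv s01; rewrite -/ph -/mu.
have hu := (pen_prox_obj_leP _ pp Du).1 (lexx _) y Fy.
have hv := (pen_prox_obj_leP _ pp Dv).1 (lexx _) y Fy.
have /andP[s0 s1] := s01; have s1' : 0 <= 1 - s by rewrite subr_ge0.
move: (ler_wpM2l s0 hu) (ler_wpM2l s1' hv) => {hu hv s0 s1 s1' s01}.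
move: (ph _ y) (ph u y) (ph v y) (p y) (pen_prox_obj p u) (pen_prox_obj p v) k0 (_ * `|_| ^+ 2).
by move: mu => m a b c d e f g h; lra.
Qed.

(** A supremum over [y] of functions with closed sublevel sets has closed
    sublevel sets. *)
Lemma pen_prox_obj_minimizer p : penalty p -> (exists b, forall x, D x -> b <= pen_obj p x) ->
  exists2 xs, D xs & forall x, D x -> pen_prox_obj p xs + mu / 2 * `|x - xs| ^+ 2 <= pen_prox_obj p x.
Proof.
move=> pp [b Hb]; have cv := ps_convex (prox_setup_X ok).
have sc := fun u v s => @pen_prox_obj_convex p u v s pp.
have h12 : 0 <= (2^-1 : R) <= 1 by rewrite invr_ge0 ler0n invf_le1 // ler1n.
have [|||||xs Dxs mxs] := @strongly_convex_minimizer _ _ D (pen_prox_obj p) (mu / 8) fX.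
- by rewrite divr_gt0.
- exact: domX_nonempty ok.
- move=> u v Du Dv.
  have -> : 2^-1 *: u + 2^-1 *: v = 2^-1 *: u + (1 - 2^-1) *: v.
    by congr (_ + _ *: _); field.
  split; first exact: cv.
  by have := sc _ _ _ Du Dv h12; lra.
- exists b => x Dx; apply: le_trans (Hb x Dx) _; rewrite lerDl.
  rewrite mulr_ge0 ?invr_ge0 ?(ltW lam0) //.
  have Uo : dgf_interior D (omX P) xk by split=> //; exact: domX_sub_omX ok _ Dxk.
  by apply: le_trans (breg_ge (prox_setup_X ok) Uo Dx); rewrite divr_ge0 ?exprn_ge0.
- move=> c.
  have -> : [set x | D x /\ pen_prox_obj p x <= c] =
      \bigcap_(y in FY) [set x | D x /\ ph x y <= c + p y - k0].
    apply/seteqP; split=> [x [Dx /(pen_prox_obj_leP _ pp Dx) h] y Fy|x h].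
      by split=> //; have := h y Fy; lra.
    have [y0 Fy0] := feasY_nonempty ok; have [Dx _] := h y0 Fy0.
    by split=> //; apply/(pen_prox_obj_leP _ pp Dx) => y Fy; have [_] := h y Fy; lra.
  by apply: closed_bigI => y Fy; exact: inner_obj_closed_sublevel.
exists xs => // x Dx.
apply: (strong_growth (U := D) (F := pen_prox_obj p)) => [s s01|//].
by split; [exact: cv|exact: sc].
Qed.

End SubproblemMinimizers.
End Minimizers.

(** * From extended-real objectives to real ones *)

Section ExtendedReals.
Context {R : realType} {X Y : normedModType R}.
Variable P : problem X Y.
Hypothesis ok : problem_ok P.
Hypothesis fX : finite_dimensional X.

Let D := domX P.
Let FY := feasY P.
Let wY : Y -> R := fine \o omY P.

Definition smooth_penalty (rho : R) (y : Y) : R := gY P y + rho * wY y.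

Lemma penalty_gY : penalty P (gY P).
Proof. exact: gY_bounded_below ok. Qed.

Lemma smooth_penalty_diff rho y : 0 <= rho -> FY y ->
  `|smooth_penalty rho y - gY P y| <= rho * RY P.
Proof.
move=> r0 Fy; rewrite /smooth_penalty addrC addKr normrM (ger0_norm r0).
by rewrite ler_wpM2l // omY_bound.
Qed.

Lemma penalty_smooth rho : 0 <= rho -> penalty P (smooth_penalty rho).
Proof.
move=> r0; have [m Hm] := penalty_gY; exists (m - rho * RY P) => y Fy.
have := smooth_penalty_diff r0 Fy; have := Hm y Fy.
by rewrite ler_norml => h /andP[h1 _]; lra.
Qed.

Lemma penalized_supE p x : penalty P p -> D x ->
  ereal_sup [set (Phi P x y - p y)%:E | y in FY]
  = (sup [set Phi P x y - p y | y in FY])%:E.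
Proof.
move=> pp Dx; rewrite -ereal_sup_EFin; first by rewrite image_comp.
  exact: penalized_ubound.
exact: penalized_nonempty.
Qed.

Lemma reg_out x : ~ D x -> reg P x = +oo%E.
Proof. by move=> nDx; apply/eqP; rewrite -leye_eq leNgt; exact/negP. Qed.

Lemma q_objE x : D x -> q_obj P x = (pen_obj P (gY P) x)%:E.
Proof.
move=> Dx; rewrite /q_obj /f_obj penalized_supE //; last exact: penalty_gY.
by rewrite (reg_fin ok Dx).
Qed.

Lemma sup_neq_ninfty (F : Y -> \bar R) : (forall y, FY y -> F y \is a fin_num) ->
  ereal_sup [set F y | y in FY] != -oo%E.
Proof.
move=> Ff; have [y Fy] := feasY_nonempty ok.
rewrite -ltNye; apply: lt_le_trans (_ : (-oo < F y)%E) _.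
  by have := Ff y Fy; rewrite fin_numElt => /andP[].
by apply: ereal_sup_ubound; exists y.
Qed.

Lemma q_obj_out x : ~ D x -> q_obj P x = +oo%E.
Proof. by move=> nDx; rewrite /q_obj (reg_out nDx) addey // sup_neq_ninfty. Qed.

Lemma f_smoothE rho x : [set ((Phi P x y - gY P y)%:E - rho%:E * omY P y)%E
    | y in FY] = [set (Phi P x y - smooth_penalty rho y)%:E | y in FY].
Proof.
have E y : FY y -> ((Phi P x y - gY P y)%:E - rho%:E * omY P y)%E
    = (Phi P x y - smooth_penalty rho y)%:E.
  move=> Fy; rewrite (omY_fin ok Fy) -EFinM -EFinB; congr EFin.
  by rewrite /smooth_penalty /wY /=; ring.
by apply/seteqP; split=> _ [y Fy <-]; exists y => //; rewrite E.
Qed.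

Lemma q_smoothE rho x : 0 <= rho -> D x ->
  q_smooth P rho x = (pen_obj P (smooth_penalty rho) x)%:E.
Proof.
move=> r0 Dx; rewrite /q_smooth /f_smooth f_smoothE penalized_supE //.
  by rewrite (reg_fin ok Dx).
exact: penalty_smooth.
Qed.

Lemma q_smooth_out rho x : ~ D x -> q_smooth P rho x = +oo%E.
Proof.
move=> nDx; rewrite /q_smooth /f_smooth f_smoothE (reg_out nDx) addey //.
exact: sup_neq_ninfty.
Qed.

Lemma pen_obj_smooth_close rho x : 0 <= rho -> D x ->
  pen_obj P (smooth_penalty rho) x <= pen_obj P (gY P) x + rho * RY P /\
  pen_obj P (gY P) x <= pen_obj P (smooth_penalty rho) x + rho * RY P.
Proof.
move=> r0 Dx; have p1 := penalty_gY; have p2 := penalty_smooth r0.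
split; apply/pen_obj_leP => // y Fy; have := smooth_penalty_diff r0 Fy;
  rewrite ler_norml => /andP[h1 h2].
  have := (pen_obj_leP ok _ p1 Dx).1 (lexx _) y Fy; lra.
have := (pen_obj_leP ok _ p2 Dx).1 (lexx _) y Fy; lra.
Qed.

Lemma pen_obj_bounded_below x : D x -> fine (q_star P) <= pen_obj P (gY P) x.
Proof.
move=> Dx; have h : (q_star P <= (pen_obj P (gY P) x)%:E)%E.
  by rewrite -q_objE //; apply: ereal_inf_lbound; exists x.
rewrite -lee_fin fineK // fin_numElt (q_bounded_below ok) /=.
exact: le_lt_trans h (ltry _).
Qed.

Lemma DeltaE x : D x ->
  fine (q_obj P x - q_star P)%E = pen_obj P (gY P) x - fine (q_star P).
Proof.
move=> Dx; rewrite q_objE //.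
have -> // : q_star P = (fine (q_star P))%:E.
rewrite fineK // fin_numElt (q_bounded_below ok) /=.
apply: le_lt_trans (ltry (pen_obj P (gY P) x)).
by rewrite -q_objE //; apply: ereal_inf_lbound; exists x.
Qed.

Section SubproblemExtended.
Variables (lam : R) (xk : X).
Hypotheses (lam0 : 0 < lam) (mu0 : 0 < mu_of P lam) (Dxk : D xk).
Let mu := mu_of P lam.
Let ph := inner_obj P lam xk.

Lemma Q_smoothE rho x : 0 <= rho -> D x ->
  Q_smooth P rho lam xk x = (pen_prox_obj P lam xk (smooth_penalty rho) x)%:E.
Proof.
by move=> r0 Dx; rewrite /Q_smooth q_smoothE // (bregmanE (prox_setup_X ok)).
Qed.

Lemma bregman_out_neq x : bregman (omX P) x xk != -oo%E.
Proof.
rewrite /bregman (omX_fin ok Dxk); have := dgf_proper (omX_dgf ok) (u := x).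
by case: (omX P x).
Qed.

Lemma scaled_bregman_neq x : (lam^-1%:E * bregman (omX P) x xk != -oo)%E.
Proof.
have := bregman_out_neq x; case: (bregman (omX P) x xk) => // _.
by rewrite gt0_muley // lte_fin invr_gt0.
Qed.

Lemma Q_smooth_out rho x : ~ D x -> Q_smooth P rho lam xk x = +oo%E.
Proof.
by move=> nDx; rewrite /Q_smooth q_smooth_out // addye // scaled_bregman_neq.
Qed.

Lemma Q_smooth_approx rho eta x : 0 <= rho -> D x ->
  (forall x', D x' -> pen_prox_obj P lam xk (smooth_penalty rho) x
     <= pen_prox_obj P lam xk (smooth_penalty rho) x' + eta) ->
  (Q_smooth P rho lam xk x <= q_env P rho lam xk + eta%:E)%E.
Proof.
move=> r0 Dx H; rewrite -leeBlDr //; apply/ereal_infP => _ [x' _ <-].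
have [Dx'|nDx'] := pselect (D x'); last by rewrite (Q_smooth_out rho nDx') leey.
by rewrite !Q_smoothE // -EFinB lee_fin lerBlDr; exact: H.
Qed.

Lemma is_proxI p : D p ->
  (forall x, D x -> pen_prox_obj P lam xk (gY P) p <= pen_prox_obj P lam xk (gY P) x) ->
  is_prox P lam xk p.
Proof.
move=> Dp H; split=> // x _.
have E z : D z -> (q_obj P z + lam^-1%:E * bregman (omX P) z xk)%E
    = (pen_prox_obj P lam xk (gY P) z)%:E.
  by move=> Dz; rewrite q_objE // (bregmanE (prox_setup_X ok)).
have [Dx|nDx] := pselect (D x); first by rewrite !E // lee_fin; exact: H.
by rewrite (q_obj_out nDx) addye ?leey // scaled_bregman_neq.
Qed.

Definition saddle_fun rho x y : R := ph x y - smooth_penalty rho y.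

Lemma saddleE rho x y : D x -> FY y ->
  saddle P lam rho xk x y = (saddle_fun rho x y)%:E.
Proof.
move=> Dx Fy; rewrite /saddle (omX_fin ok Dx) (reg_fin ok Dx) (omY_fin ok Fy).
rewrite -[LHS]/(_%:E); congr EFin.
rewrite /saddle_fun /ph /inner_obj /smooth_penalty /wY /=.
by move: (fine _) (fine _) (fine _) => *; ring.
Qed.

(** The infimum in the gap is attained, hence finite, so the extended-real
    subtraction is never between equal infinities. *)
Lemma duality_gapP rho eta x y : D x -> FY y ->
  (duality_gap P lam rho xk x y <= eta%:E)%E <->
  forall x' y', D x' -> FY y' -> saddle_fun rho x y' <= saddle_fun rho x' y + eta.
Proof.
move=> Dx Fy; have [xs Dxs mx] := inner_obj_argmin ok fX mu0 Dxk Fy.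
have infE : ereal_inf [set saddle P lam rho xk x' y | x' in D] = (saddle_fun rho xs y)%:E.
  apply/eqP; rewrite eq_le; apply/andP; split.
    by rewrite -saddleE //; apply: ereal_inf_lbound; exists xs.
  apply/ereal_infP => _ [x' Dx' <-]; rewrite saddleE // lee_fin /saddle_fun lerD2r.
  exact: mx.
rewrite /duality_gap infE leeBlDr //; split=> [h x' y' Dx' Fy'|h].
  rewrite -lee_fin -saddleE //.
  apply: (@le_trans _ _ (eta%:E + (saddle_fun rho xs y)%:E)%E).
    by apply: le_trans h; apply: ereal_sup_ubound; exists y'.
  by rewrite -EFinD lee_fin addrC lerD2r /saddle_fun lerD2r; exact: mx.
apply: ge_ereal_sup => _ [y' Fy' <-]; rewrite saddleE // -EFinD lee_fin addrC.
exact: h.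
Qed.

(** Weak duality: the gap bounds the suboptimality of [x] for the smoothed
    proximal objective. *)
Lemma gap_pen_prox_obj rho eta x y : 0 <= rho -> D x -> FY y ->
  (duality_gap P lam rho xk x y <= eta%:E)%E ->
  forall x', D x' -> pen_prox_obj P lam xk (smooth_penalty rho) x
     <= pen_prox_obj P lam xk (smooth_penalty rho) x' + eta.
Proof.
move=> r0 Dx Fy /(duality_gapP _ _ Dx Fy) h x' Dx'; have pp := penalty_smooth r0.
apply/(pen_prox_obj_leP ok lam xk _ pp Dx) => y' Fy'; have := h x' y' Dx' Fy'.
have := (pen_prox_obj_leP ok lam xk _ pp Dx').1 (lexx _) y Fy; rewrite /saddle_fun /ph.
by move: (_ * _) => k; lra.
Qed.

Lemma primal_gapP acc x y : D x -> FY y ->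
  (psiP P lam xk x y - pi_dual P lam xk y <= acc%:E)%E <->
  forall x', D x' -> ph x y <= ph x' y + acc.
Proof.
move=> Dx Fy; have [xs Dxs mx] := inner_obj_argmin ok fX mu0 Dxk Fy.
have infE : pi_dual P lam xk y = (ph xs y)%:E.
  apply/eqP; rewrite eq_le; apply/andP; split.
    by rewrite -(psiP_inner_obj ok) //; apply: ereal_inf_lbound; exists xs.
  by apply/ereal_infP => _ [x' Dx' <-]; rewrite (psiP_inner_obj ok) // lee_fin mx.
rewrite infE (psiP_inner_obj ok) // -EFinB lee_fin lerBlDr -/ph addrC; split=> [h x' Dx'|].
  by apply: le_trans h _; rewrite lerD2r mx.
exact.
Qed.

End SubproblemExtended.
End ExtendedReals.

(** * The primal solver *)

Section PrimalSolver.
Context {R : realType} {X Y : normedModType R}.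
Variable P : problem X Y.
Hypothesis ok : problem_ok P.
Hypothesis fX : finite_dimensional X.

Let D := domX P.
Let FY := feasY P.
Let rr : X -> R := fine \o reg P.
Let wX : X -> R := fine \o omX P.

Lemma Lxx'_gt0 : 0 < Lxx' P.
Proof.
have g0 := gamma_gt0 ok; rewrite /Lxx' ltr_pwDl //.
  exact: lt_le_trans g0 (gamma_le ok).
by rewrite mulr_ge0 ?(ltW g0) // (le_trans ler01 (betaX_ge1 ok)).
Qed.

Section PrimalSolverAt.
Variables (lam : R) (xk : X).
Hypotheses (mu0 : 0 < mu_of P lam) (Dxk : D xk).
Let mu := mu_of P lam.
Let ph := inner_obj P lam xk.

(** The tangents of the convex function [Psi ^~ y] are lower models, and the
    descent lemma makes them upper models with curvature [Lxx']. *)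
Lemma primal_apg_bound y n tr : FY y ->
  is_apg D (omX P) (reg P) mu (Lxx' P)
    (fun t => 'd ((Psi P lam xk) ^~ y) (apg_u tr t)) n tr ->
  forall t x, (t <= n)%N -> D x ->
  apg_A (mu / Lxx' P) t * ph (apg_z tr t) y
    <= apg_A (mu / Lxx' P) t * ph x y + Lxx' P * breg wX x (apg_u tr 0).
Proof.
move=> Fy apg t x tn Dx.
have feas := apg_feasible (prox_setup_X ok) apg.
have := @apg_estimate_bound _ _ _ _ _ (prox_setup_X ok) mu (Lxx' P) _ mu0 Lxx'_gt0
  (fun t => scalar_diff _ _) n tr (Psi P lam xk ^~ y)
  (fun t => Psi P lam xk (apg_u tr t) y
            - 'd ((Psi P lam xk) ^~ y) (apg_u tr t) (apg_u tr t)) 0 apg.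
have lo s v : (s <= n)%N -> D v -> Psi P lam xk (apg_u tr s) y
    - 'd ((Psi P lam xk) ^~ y) (apg_u tr s) (apg_u tr s)
    + 'd ((Psi P lam xk) ^~ y) (apg_u tr s) v <= Psi P lam xk v y.
  move=> sn Dv; have := Psi_grad_lower ok lam Dxk (feas s sn).1 Dv Fy.
  by rewrite linearB /= => h; rewrite -addrA [- _ + _]addrC.
have up s v : (s <= n)%N -> D v -> Psi P lam xk v y <= Psi P lam xk (apg_u tr s) y
    - 'd ((Psi P lam xk) ^~ y) (apg_u tr s) (apg_u tr s)
    + 'd ((Psi P lam xk) ^~ y) (apg_u tr s) v
    + Lxx' P / 2 * `|v - apg_u tr s| ^+ 2 + 0.
  move=> sn Dv; have := Psi_grad_upper ok lam Dxk (feas s sn).1 Dv Fy.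
  by rewrite linearB /= addr0 => h; rewrite -[_ - _ + _]addrA [- _ + _]addrC.
move=> /(_ lo up t tn x Dx).
rewrite mul0r addr0 /apg_estimate /ph /inner_obj -/mu -/rr -/wX => h.
apply: le_trans h _; rewrite lerD2r -[X in _ <= _ * X]addrA [X in _ <= X]mulrDr lerD2r.
rewrite /apg_A mulr_suml ler_sum_nat // => i /andP[_ it].
rewrite ler_wpM2l ?apg_alpha_ge0 //; apply: lo => //.
by rewrite ltnS in it; exact: leq_trans it tn.
Qed.

Lemma apg_growth theta (c : R) : 0 < theta -> exists n, c <= apg_A theta n.
Proof.
move=> th0; have s0 : 0 < Num.sqrt theta by rewrite sqrtr_gt0.
exists (Num.truncn (c / Num.sqrt theta)).+1; rewrite apg_AE.
have : c / Num.sqrt theta < (Num.truncn (c / Num.sqrt theta)).+1%:R by exact: truncnS_gt.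
move: (Num.truncn _).+1 => n; rewrite ltr_pdivrMr // => h.
apply: le_trans (ltW h) _.
elim: n {h} => [|n IH]; first by rewrite mul0r expr0.
have A1 : 1 <= (1 + Num.sqrt theta) ^+ n by rewrite exprn_ege1 // lerDl ltW.
rewrite exprS mulrDl mul1r -natr1 mulrDl mul1r lerD //.
by rewrite ler_peMr // ltW.
Qed.

Lemma first_indexP (Q : nat -> Prop) : (exists n, Q n) -> exists n, first_index Q n.
Proof.
move=> [n Qn]; have [m /asboolP Qm mn] := ex_minnP (ex_intro (fun n => `[<Q n>]) n (asboolT Qn)).
by exists m; split=> // k km /asboolT /mn; rewrite leqNgt km.
Qed.

Lemma primal_solve_exists y acc u0 : FY y -> 0 < acc -> dgf_interior D (omX P) u0 ->
  exists n tr, primal_solve P lam acc xk y n tr /\ apg_u tr 0 = u0.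
Proof.
move=> Fy acc0 Uo; have [tr [tr0 apg]] := apg_exists (prox_setup_X ok)
  (Gf := fun _ u => 'd ((Psi P lam xk) ^~ y) u) mu0 Lxx'_gt0
  (fun t u => scalar_diff _ _) Uo.
have [xs Dxs mx] := inner_obj_argmin ok fX mu0 Dxk Fy.
have th0 : 0 < mu / Lxx' P by rewrite divr_gt0 // Lxx'_gt0.
have [n Hn] := apg_growth (Lxx' P * breg wX xs u0 / acc) th0.
have [|m fm] := @first_indexP (fun t => psiP P lam xk (apg_z tr t) y
    - pi_dual P lam xk y <= acc%:E)%E.
  exists n; apply/(primal_gapP ok fX mu0 Dxk) => //.
    by have [_] := apg_feasible (prox_setup_X ok) (apg n) (leqnn n).
  move=> x' Dx'; apply: le_trans (lerD (mx x' Dx') (lexx acc)).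
  have A0 := apg_A_gt0 (mu / Lxx' P) n.
  have := primal_apg_bound Fy (apg n) (leqnn n) Dxs; rewrite tr0 => h.
  rewrite -(ler_pM2l A0) [X in _ <= X]mulrDr; apply: le_trans h _; rewrite lerD2l.
  by move: Hn; rewrite ler_pdivrMr.
by exists m, tr; split=> //; split=> //; exact: apg.
Qed.

(** The Bregman distance is measured from the minimiser only, which is where
    [starts_within] bounds it. *)
Lemma primal_solve_unfinished y acc n tr B : FY y -> 0 < acc ->
  primal_solve P lam acc xk y n tr ->
  (forall xs, argmin_on D (fun x => psiP P lam xk x y) xs ->
     (bregman (omX P) xs (apg_u tr 0) <= B%:E)%E) ->
  forall t, (t < n)%N -> apg_A (mu / Lxx' P) t * acc < Lxx' P * B.
Proof.
move=> Fy acc0 [apg [_ fi]] HB t tn; rewrite ltNge; apply/negP => h.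
apply: (fi t tn).
have [_ Dz] := apg_feasible (prox_setup_X ok) apg (ltnW tn).
apply/(primal_gapP ok fX mu0 Dxk) => // x' Dx'.
have [xs Dxs mx] := inner_obj_argmin ok fX mu0 Dxk Fy.
apply: le_trans (lerD (mx x' Dx') (lexx acc)).
have A0 := apg_A_gt0 (mu / Lxx' P) t.
have Du0 : D (apg_u tr 0) by have [[]] := apg.
have brB : breg wX xs (apg_u tr 0) <= B.
  rewrite -lee_fin -(bregmanE (prox_setup_X ok)) //; apply: HB; split=> // x Dx.
  by rewrite !(psiP_inner_obj ok) // lee_fin; exact: mx.
have hi := primal_apg_bound Fy apg (ltnW tn) Dxs.
rewrite -(ler_pM2l A0) [X in _ <= X]mulrDr; apply: le_trans hi _; rewrite lerD2l.
by apply: le_trans h; rewrite ler_pM2l // Lxx'_gt0.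
Qed.

End PrimalSolverAt.
End PrimalSolver.

(** * The dual function and its inexact linear models *)

Section DualModel.
Context {R : realType} {X Y : normedModType R}.
Variable P : problem X Y.
Hypothesis ok : problem_ok P.
Hypothesis fX : finite_dimensional X.

Let D := domX P.
Let FY := feasY P.
Let wX : X -> R := fine \o omX P.

(** Averaging is a sequence of convex combinations, so convexity can be used one
    step at a time. *)
Lemma xbarS (theta : R) (xh : nat -> X) t :
  xbar theta xh t.+1 = (1 - apg_tau theta t.+1) *: xbar theta xh t
    + apg_tau theta t.+1 *: xh t.+1.
Proof.
have A0 := apg_A_gt0 theta t; have A1 := apg_A_gt0 theta t.+1.
rewrite /xbar big_nat_recr // scalerDr scalerA [(_)^-1 * _]mulrC -/(apg_tau _ _).
rewrite scalerA; congr (_ *: _ + _); rewrite /apg_tau.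
have -> : apg_alpha theta t.+1 = apg_A theta t.+1 - apg_A theta t.
  by rewrite apg_AS addrC addKr.
by field; rewrite !gt_eqF.
Qed.

Lemma xbar0 (theta : R) (xh : nat -> X) : xbar theta xh 0 = xh 0.
Proof. by rewrite /xbar /apg_A !big_nat1 invr1 !scale1r. Qed.

Lemma xbar_mem theta (xh : nat -> X) t :
  (forall i, (i <= t)%N -> D (xh i)) -> D (xbar theta xh t).
Proof.
elim: t => [|t IH] Dx; first by rewrite xbar0; exact: Dx.
rewrite xbarS addrC; apply: (ps_convex (prox_setup_X ok)); first exact: Dx.
  by apply: IH => i it; exact/Dx/ltnW.
exact: apg_tau_itv.
Qed.

Section DualModelAt.
Variables (lam : R) (xk : X).
Hypotheses (mu0 : 0 < mu_of P lam) (Dxk : D xk).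
Let mu := mu_of P lam.
Let ph := inner_obj P lam xk.

Lemma xbar_jensen theta (xh : nat -> X) t y : FY y ->
  (forall i, (i <= t)%N -> D (xh i)) ->
  apg_A theta t * ph (xbar theta xh t) y
    <= \sum_(0 <= i < t.+1) apg_alpha theta i * ph (xh i) y.
Proof.
move=> Fy; elim: t => [|t IH] Dx.
  by rewrite xbar0 /apg_A !big_nat1.
have Dt i : (i <= t)%N -> D (xh i) by move=> it; exact/Dx/ltnW.
rewrite big_nat_recr //; apply: le_trans (lerD (IH Dt) (lexx _)).
have A1 := apg_A_gt0 theta t.+1.
have /andP[t0 t1] := apg_tau_itv theta t.
have := inner_obj_convex ok mu0 Dxk Fy (Dx _ (leqnn _)) (xbar_mem theta Dt) (apg_tau_itv theta t).
rewrite -/ph => h; rewrite xbarS [X in ph X]addrC.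
have : ph (apg_tau theta t.+1 *: xh t.+1 + (1 - apg_tau theta t.+1) *: xbar theta xh t) y
   <= apg_tau theta t.+1 * ph (xh t.+1) y + (1 - apg_tau theta t.+1) * ph (xbar theta xh t) y.
  apply: le_trans h; rewrite lerDl mulr_ge0 // ?(ltW mu0) // mulr_ge0 ?exprn_ge0 //.
  by rewrite divr_ge0 // mulr_ge0 // subr_ge0.
rewrite -(ler_pM2l A1) => h2; apply: le_trans h2 _.
have tE : apg_tau theta t.+1 * apg_A theta t.+1 = apg_alpha theta t.+1.
  by rewrite /apg_tau divfK // gt_eqF.
have AE : apg_A theta t = (1 - apg_tau theta t.+1) * apg_A theta t.+1.
  by rewrite mulrBl tE apg_AS; ring.
rewrite AE -tE.
move: (ph _ y) (ph _ y) (apg_tau _ _) (apg_A _ _) => a b c d.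
by rewrite le_eqVlt; apply/orP; left; apply/eqP; ring.
Qed.

Lemma Psi_y_diff x y : D x -> FY y -> 'd (Psi P lam xk x) y = 'd (Phi P x) y :> (Y -> R).
Proof.
move=> Dx Fy; pose c := gamma P * wX x - lam^-1 * 'd wX xk x.
have h : is_diff y (Phi P x) ('d (Phi P x) y).
  by apply: DiffDef => //; exact: (Phi_y_diff ok).
have h2 := is_diffD (is_diff_cst c y) h.
have -> : Psi P lam xk x = cst c + Phi P x by apply/funext.
by rewrite (diff_val (is_diff_def := h2)) add0r.
Qed.

Lemma inner_objB x y y' : ph x y' - ph x y = Phi P x y' - Phi P x y.
Proof. by rewrite /ph /inner_obj /Psi; ring. Qed.

(** [inner_obj xh] is concave, being [Phi xh] up to a constant. *)
Lemma dual_lower xh yt y : D xh -> FY yt -> FY y ->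
  ph xh y <= ph xh yt + 'd (Phi P xh) yt (y - yt).
Proof.
move=> Dxh Fyt Fy; rewrite -lerBlDl inner_objB lerBlDl.
exact: Phi_y_upper.
Qed.

(** Moving from the approximate solution [xh] to any [x] changes the gradient in
    [y] by at most [Lxy * `|xh - x|], and the strong convexity of
    [inner_obj ^~ yt] charges for that distance.  Going through the exact
    minimiser [xs] costs [Lxy ^ 2 / (2 * mu)] twice, whence the factor 2 in front
    of [Lpi], and half of [eps]; the other half comes from replacing the minimum
    by the value at [xh]. *)
Lemma dual_upper eps xh yt y x : D xh -> FY yt -> FY y -> D x -> 0 <= eps ->
  (forall x', D x' -> ph xh yt <= ph x' yt + eps / 2) ->
  ph xh yt + 'd (Phi P xh) yt (y - yt)
    - 2 * Lpi P lam / 2 * `|y - yt| ^+ 2 - eps <= ph x y.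
Proof.
move=> Dxh Fyt Fy Dx eps0 Hxh; set d := `|y - yt|; have d0 : 0 <= d by exact: normr_ge0.
have [xs Dxs mxs] := inner_obj_minimizer ok fX mu0 Dxk Fyt.
have h1 := Phi_y_lower ok Dx Fyt Fy; rewrite -/d in h1.
have h2 := le_trans (le_dual_diffB (y - yt) (Phi_y_diff ok Dxh Fyt) (Phi_y_diff ok Dx Fyt))
  (ler_wpM2r d0 (grad_y_lip_x ok Dxh Dx Fyt)).
have h3 := mxs x Dx; have h4 := mxs xh Dxh; have h5 := Hxh xs Dxs.
rewrite -/ph -/mu in h3 h4.
have tri : `|xh - x| <= `|x - xs| + `|xh - xs|.
  by rewrite [X in _ <= X]addrC [`|x - xs|]distrC; exact: ler_distD.
set a := `|x - xs| in h3 tri; set b := `|xh - xs| in h4 tri.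
have h6 : Lxy P * `|xh - x| * d <= Lxy P * (a + b) * d.
  by apply: ler_wpM2r => //; apply: ler_wpM2l => //; exact: Lxy_ge0 ok.
have E := inner_objB x yt y.
(* Young's inequality, once for each of the two distances to the minimiser *)
have young (c : R) : Lxy P * c * d <= mu / 2 * c ^+ 2 + Lxy P ^+ 2 / mu / 2 * d ^+ 2.
  rewrite -subr_ge0; set Z := (X in 0 <= X).
  have -> : Z = mu / 2 * (c - Lxy P / mu * d) ^+ 2.
    by rewrite /Z; field; rewrite gt_eqF.
  by rewrite mulr_ge0 ?exprn_even_ge0 // divr_ge0 // ltW.
have ya := young a; have yb := young b.
have Ld : 0 <= Lyy P * d ^+ 2 by rewrite mulr_ge0 ?exprn_ge0 // (Lyy_ge0 ok).
rewrite /Lpi -/mu.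
move: Ld h1 h2 h3 h4 h5 h6 E ya yb.
move: (Lxy P ^+ 2 / mu) ('d _ _ _) ('d _ _ _) (Phi P x y) (Phi P x yt) => k l1 l2 p1 p2.
rewrite mulrDr mulrDl.
move: (Lxy P * a * d) (Lxy P * b * d) (Lxy P * _ * d) (d ^+ 2) (mu / 2 * a ^+ 2) (mu / 2 * b ^+ 2).
move: (ph x y) (ph x yt) (ph xh yt) (ph xs yt) (Lyy P).
by clear -eps0; move=> *; lra.
Qed.

End DualModelAt.
End DualModel.

(** * The duality gap of the dual solver *)

Section DualSolver.
Context {R : realType} {X Y : normedModType R}.
Variable P : problem X Y.
Hypothesis ok : problem_ok P.
Hypothesis fX : finite_dimensional X.

Let D := domX P.
Let FY := feasY P.
Let wY : Y -> R := fine \o omY P.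

Section DualSolverAt.
Variables (lam : R) (xk : X).
Hypotheses (mu0 : 0 < mu_of P lam) (Dxk : D xk).
Let mu := mu_of P lam.
Let ph := inner_obj P lam xk.
Let L := 2 * Lpi P lam.

Lemma Lpi_gt0 : 0 < Lpi P lam.
Proof.
rewrite /Lpi -/mu; have [y0 | y0] := ltP 0 (Lyy P).
  by rewrite ltr_pwDl // mulr_ge0 ?exprn_ge0 ?(Lxy_ge0 ok) // invr_ge0 ltW.
have x0 : 0 < Lxy P by have := Lxy_Lyy_gt0 ok; lra.
rewrite addrC ltr_pwDl ?(Lyy_ge0 ok) //.
by rewrite divr_gt0 // exprn_gt0.
Qed.

(** The dual function is [h y = - inner_obj (xs y) y].  The lower models also lie
    below each [- inner_obj (xh i)], so their weighted average is at most
    [- inner_obj] at the averaged point, which is the primal side of the gap. *)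
Lemma dual_apg_bound rho (xh : nat -> X) eps n tr : 0 < rho -> 0 <= eps ->
  is_apg FY (omY P) (EFin \o gY P) rho L
    (fun t v => - 'd (Psi P lam xk (xh t)) (apg_u tr t) v) n tr ->
  (forall i, (i <= n)%N -> D (xh i) /\
     forall x', D x' -> ph (xh i) (apg_u tr i) <= ph x' (apg_u tr i) + eps / 2) ->
  forall t x' y', (t <= n)%N -> D x' -> FY y' ->
  apg_A (rho / L) t * saddle_fun P lam xk rho (xbar (rho / L) xh t) y'
    <= apg_A (rho / L) t * saddle_fun P lam xk rho x' (apg_z tr t)
       + L * breg wY y' (apg_u tr 0)
       + eps * \sum_(0 <= i < t.+1) apg_A (rho / L) i.
Proof.
move=> rho0 eps0 apg Hxh t x' y' tn Dx' Fy'.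
have L0 : 0 < L by rewrite mulr_gt0 // Lpi_gt0.
have feas := apg_feasible (prox_setup_Y ok) apg.
have /choice[xs Hxs] : forall y, exists xs, FY y ->
    D xs /\ forall x, D x -> ph xs y <= ph x y.
  move=> y; have [Fy|nFy] := pselect (FY y); last by exists xk.
  by have [z Dz mz] := inner_obj_argmin ok fX mu0 Dxk Fy; exists z.
pose G s v := - 'd (Psi P lam xk (xh s)) (apg_u tr s) v.
pose e s := - ph (xh s) (apg_u tr s) - G s (apg_u tr s).
have Glin s : scalar (G s).
  by move=> a u v; rewrite /G (scalar_diff _ _ a u v); ring.
have GE s v : (s <= n)%N -> e s + G s v = - (ph (xh s) (apg_u tr s)
    + 'd (Phi P (xh s)) (apg_u tr s) (v - apg_u tr s)).
  move=> sn; rewrite /e /G !(Psi_y_diff ok lam xk (Hxh s sn).1 (feas s sn).1).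
  by rewrite linearB /=; move: (ph _ _) ('d _ _ _) ('d _ _ _) => *; ring.
have lo1 s v : (s <= n)%N -> FY v -> e s + G s v <= - ph (xh s) v.
  move=> sn Fv; rewrite GE // lerN2.
  by apply: (dual_lower ok); [exact: (Hxh s sn).1|exact: (feas s sn).1|].
pose h y := - ph (xs y) y.
have lo s v : (s <= n)%N -> FY v -> e s + G s v <= h v.
  move=> sn Fv; apply: le_trans (lo1 s v sn Fv) _; rewrite lerN2.
  by apply: (Hxs v Fv).2; exact: (Hxh s sn).1.
have up s v : (s <= n)%N -> FY v ->
    h v <= e s + G s v + L / 2 * `|v - apg_u tr s| ^+ 2 + eps.
  move=> sn Fv; rewrite GE //.
  have := dual_upper ok fX mu0 Dxk (Hxh s sn).1 (feas s sn).1 Fv (Hxs v Fv).1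
    eps0 (Hxh s sn).2.
  by rewrite /h -/ph -/L; move: (ph _ _) (ph _ _) ('d _ _ _) (_ * _) => *; lra.
have := apg_estimate_bound (prox_setup_Y ok) rho0 L0 Glin apg lo up tn Fy'.
set A := apg_A _; set z := apg_z tr t; rewrite /apg_estimate -/A.
have [_ Fz] := feas t tn; rewrite -/z in Fz.
have hz : - ph x' z <= h z by rewrite lerN2; exact: (Hxs z Fz).2.
have A0 : 0 < A t := apg_A_gt0 _ _.
have sumle : \sum_(0 <= i < t.+1) apg_alpha (rho / L) i * (e i + G i y')
    <= - (A t * ph (xbar (rho / L) xh t) y').
  apply: (@le_trans _ _ (- \sum_(0 <= i < t.+1) apg_alpha (rho / L) i * ph (xh i) y')).
    rewrite -sumrN ler_sum_nat // => i /andP[_]; rewrite ltnS => it.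
    rewrite -mulrN ler_wpM2l ?apg_alpha_ge0 //; apply: lo1 => //.
    exact: leq_trans it tn.
  rewrite lerN2; apply: (xbar_jensen ok mu0 Dxk) => // i it.
  by apply: (Hxh i _).1; exact: leq_trans it tn.
have := ler_wpM2l (ltW A0) hz.
rewrite /saddle_fun /smooth_penalty -/ph /= -/wY => h1 h2.
move: (le_trans h2 (lerD (lerD (lerD sumle (lexx _)) (lexx _)) (lexx _))) h1.
rewrite -[fine (omY P z)]/(wY z) -[fine (omY P y')]/(wY y').
move: (ph _ _) (ph _ _) (wY z) (wY y') (h z) (breg _ _ _) (\sum_(_ <= _ < _) _) (A t).
move: (gY P z) (gY P y') L.
by move=> *; lra.
Qed.

(** Half of [eta] pays for the accumulated inner errors, by the choice of [eps];
    the other half for the initial Bregman distance. *)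
Lemma dual_apg_gap rho eta (xh : nat -> X) n tr B t : 0 < rho -> 0 < eta ->
  let eps := eta / (2 * (1 + Num.sqrt (2 * Lpi P lam / rho))) in
  is_apg FY (omY P) (EFin \o gY P) rho L
    (fun t v => - 'd (Psi P lam xk (xh t)) (apg_u tr t) v) n tr ->
  (forall i, (i <= n)%N -> D (xh i) /\
     forall x', D x' -> ph (xh i) (apg_u tr i) <= ph x' (apg_u tr i) + eps / 2) ->
  (forall y, FY y -> breg wY y (apg_u tr 0) <= B) ->
  (t <= n)%N -> L * B <= apg_A (rho / L) t * (eta / 2) ->
  (duality_gap P lam rho xk (xbar (rho / L) xh t) (apg_z tr t) <= eta%:E)%E.
Proof.
move=> rho0 eta0 eps apg Hxh HB tn HA.
have L0 : 0 < L by rewrite mulr_gt0 // Lpi_gt0.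
have eps0 : 0 <= eps.
  by rewrite divr_ge0 ?(ltW eta0) // mulr_ge0 // addr_ge0 // sqrtr_ge0.
have [_ Fz] := apg_feasible (prox_setup_Y ok) apg tn.
apply/(duality_gapP ok fX mu0 Dxk) => //.
  apply: (xbar_mem ok) => i it; apply: (Hxh i _).1; exact: leq_trans it tn.
move=> x' y' Dx' Fy'.
have := dual_apg_bound rho0 eps0 apg Hxh tn Dx' Fy'.
have th0 : 0 < rho / L by rewrite divr_gt0.
have sA := ler_wpM2l eps0 (sum_apg_A_le t th0).
have A0 := apg_A_gt0 (rho / L) t.
have sE : eps * (apg_A (rho / L) t * (1 + (Num.sqrt (rho / L))^-1))
    = apg_A (rho / L) t * (eta / 2).
  have -> : (Num.sqrt (rho / L))^-1 = Num.sqrt (2 * Lpi P lam / rho).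
    by rewrite -sqrtrV ?ltW // invf_div.
  by rewrite /eps; field; rewrite gt_eqF // ltr_pwDl // sqrtr_ge0.
have hB := ler_wpM2l (ltW L0) (HB y' Fy').
rewrite sE in sA => h1.
rewrite -(ler_pM2l A0) [X in _ <= X]mulrDr.
apply: le_trans h1 _; rewrite -addrA lerD2l.
apply: le_trans (lerD (le_trans hB HA) sA) _.
by rewrite -mulrDr; have -> : eta / 2 + eta / 2 = eta by field.
Qed.

End DualSolverAt.
End DualSolver.

(** * Solved subproblems and outer iterations *)

Section Execution.
Context {R : realType} {X Y : normedModType R}.
Variable P : problem X Y.
Hypothesis ok : problem_ok P.
Hypothesis fX : finite_dimensional X.

Let D := domX P.
Let FY := feasY P.
Let wX : X -> R := fine \o omX P.
Let lam := lam_of P.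

Lemma lam_gt0 : 0 < lam.
Proof. by rewrite mulr_gt0 ?invr_gt0 ?(gamma_gt0 ok) // divr_gt0. Qed.

Lemma lamV : lam^-1 = 10%:R / 9%:R * gamma P.
Proof. by rewrite /lam /lam_of invfM invrK invf_div. Qed.

Lemma mu_ofE : mu_of P lam = gamma P / 9%:R.
Proof. by rewrite /mu_of lamV; field. Qed.

Lemma mu_gt0 : 0 < mu_of P lam.
Proof. by rewrite mu_ofE divr_gt0 // (gamma_gt0 ok). Qed.

Lemma lam_lt : 0 < lam < (gamma P)^-1.
Proof.
rewrite lam_gt0 /= /lam /lam_of gtr_pMl ?invr_gt0 ?(gamma_gt0 ok) //.
by rewrite ltr_pdivrMr // mul1r ltr_nat.
Qed.

Section Accuracy.
Variable eta : R.
Hypothesis eta0 : 0 < eta.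
Let rho := rho_of P eta.
Let pen := smooth_penalty P rho.

Lemma rho_gt0 : 0 < rho.
Proof. by rewrite divr_gt0 ?mulr_gt0 // RY_pos. Qed.

Lemma rho_RY : rho * RY P = 2 * eta.
Proof. by rewrite /rho /rho_of divfK // gt_eqF // RY_pos. Qed.

Lemma epsbar_gt0 : 0 < epsbar P lam eta.
Proof.
by rewrite divr_gt0 // mulr_gt0 // ltr_pwDl // sqrtr_ge0.
Qed.

Lemma primal_solve_spec xk y acc n tr : D xk -> FY y ->
  primal_solve P lam acc xk y n tr -> D (apg_z tr n) /\
  forall x', D x' -> inner_obj P lam xk (apg_z tr n) y <= inner_obj P lam xk x' y + acc.
Proof.
move=> Dxk Fy [apg [fi _]].
have [_ Dz] := apg_feasible (prox_setup_X ok) apg (leqnn n); split=> //.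
exact/(primal_gapP ok fX mu_gt0 Dxk _ Dz Fy).
Qed.

(** The inner solutions are chosen for every query point beforehand; this makes
    the inexact gradient a function of the query point, as the construction of a
    trace requires. *)
Lemma dual_solve_exists xk y0 (sx : nat -> X) : D xk ->
  dgf_interior FY (omY P) y0 -> (forall i, dgf_interior D (omX P) (sx i)) ->
  exists (dtr : apg_trace Y) (dlen : nat) (ptr : nat -> apg_trace X)
    (plen : nat -> nat) (xn : X),
  [/\ forall i, (i <= dlen)%N -> primal_solve P lam (epsbar P lam eta / 2) xk
        (apg_u dtr i) (plen i) (ptr i) /\ apg_u (ptr i) 0 = sx i,
      dual_solve P lam eta xk (fun i => apg_z (ptr i) (plen i)) dlen dtr xn,
      apg_u dtr 0 = y0 & D xn].
Proof.
move=> Dxk Uy0 Usx.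
have acc0 : 0 < epsbar P lam eta / 2 by rewrite divr_gt0 // epsbar_gt0.
have /choice[sol Hsol] : forall iy : nat * Y, exists s : nat * apg_trace X,
    FY iy.2 -> primal_solve P lam (epsbar P lam eta / 2) xk iy.2 s.1 s.2 /\
      apg_u s.2 0 = sx iy.1.
  move=> [i y] /=; have [Fy|nFy] := pselect (FY y); last first.
    by exists (0%N, ApgTrace (fun=> 0) (fun=> 0) (fun=> 0) (fun=> 0)).
  have [n [tr H]] := primal_solve_exists ok fX mu_gt0 Dxk Fy acc0 (Usx i).
  by exists (n, tr).
pose xh i y := apg_z (sol (i, y)).2 (sol (i, y)).1.
pose L := 2 * Lpi P lam; have L0 : 0 < L by rewrite mulr_gt0 // (Lpi_gt0 ok) // mu_gt0.
have Gl (i : nat) y : scalar (fun v => - 'd (Psi P lam xk (xh i y)) y v).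
  by move=> a u v; rewrite (scalar_diff _ _ a u v); ring.
have [dtr [d0 apg]] := apg_exists (prox_setup_Y ok) rho_gt0 L0 Gl Uy0.
have Fu i : FY (apg_u dtr i).
  by have [] := apg_feasible (prox_setup_Y ok) (apg i) (leqnn i).
pose ptr i := (sol (i, apg_u dtr i)).2; pose plen i := (sol (i, apg_u dtr i)).1.
have Hs i : primal_solve P lam (epsbar P lam eta / 2) xk (apg_u dtr i) (plen i) (ptr i)
    /\ apg_u (ptr i) 0 = sx i by exact: (Hsol (i, apg_u dtr i) (Fu i)).
have Hx i := primal_solve_spec Dxk (Fu i) (Hs i).1.
have [B HB] := breg_omY_bounded ok Uy0.
have th0 : 0 < rho / L by rewrite divr_gt0 // rho_gt0.
have [n Hn] := apg_growth (L * B / (eta / 2)) th0.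
have Du i : D (apg_z (ptr i) (plen i)) by exact: (Hx i).1.
have [|m fm] := @first_indexP (fun t => duality_gap P lam rho xk
    (xbar (rho / L) (fun i => apg_z (ptr i) (plen i)) t) (apg_z dtr t) <= eta%:E)%E.
  exists n; apply: (dual_apg_gap ok fX mu_gt0 Dxk rho_gt0 eta0 (apg n) (B := B)) => //.
  - by move=> i _; exact: Hx.
  - by rewrite d0.
  - by move: Hn; rewrite ler_pdivrMr // divr_gt0.
exists dtr, m, ptr, plen, (xbar (rho / L) (fun i => apg_z (ptr i) (plen i)) m).
by split=> //; apply: (xbar_mem ok) => i _; exact: Du.
Qed.

Lemma dual_solve_spec xk n tr plen ptr xn : D xk ->
  (forall i, (i <= n)%N -> primal_solve P lam (epsbar P lam eta / 2) xk
     (apg_u tr i) (plen i) (ptr i)) ->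
  dual_solve P lam eta xk (fun i => apg_z (ptr i) (plen i)) n tr xn ->
  D xn /\ forall x', D x' -> pen_prox_obj P lam xk pen xn <= pen_prox_obj P lam xk pen x' + eta.
Proof.
move=> Dxk Hp [apg [gap _] ->].
have feas := apg_feasible (prox_setup_Y ok) apg.
have Hx i : (i <= n)%N -> D (apg_z (ptr i) (plen i)).
  by move=> i_n; exact: (primal_solve_spec Dxk (feas i i_n).1 (Hp i i_n)).1.
have Dn := xbar_mem ok (rho / (2 * Lpi P lam)) Hx; split=> //.
exact: (gap_pen_prox_obj ok fX mu_gt0 Dxk (ltW rho_gt0) Dn (feas n (leqnn n)).2 gap).
Qed.

Lemma dual_solve_unfinished xk n tr plen ptr xn B : D xk ->
  (forall i, (i <= n)%N -> primal_solve P lam (epsbar P lam eta / 2) xk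
     (apg_u tr i) (plen i) (ptr i)) ->
  dual_solve P lam eta xk (fun i => apg_z (ptr i) (plen i)) n tr xn ->
  (forall y, FY y -> (bregman (omY P) y (apg_u tr 0) <= B%:E)%E) ->
  forall t, (t < n)%N ->
  apg_A (rho / (2 * Lpi P lam)) t * (eta / 2) < 2 * Lpi P lam * B.
Proof.
move=> Dxk Hp [apg [_ fi] _] HB t tn; rewrite ltNge; apply/negP => h.
have feas := apg_feasible (prox_setup_Y ok) apg.
apply: (fi t tn).
apply: (dual_apg_gap ok fX mu_gt0 Dxk rho_gt0 eta0 apg (B := B)) => //.
- by move=> i i_n; exact: (primal_solve_spec Dxk (feas i i_n).1 (Hp i i_n)).
- move=> y Fy; rewrite -lee_fin -(bregmanE (prox_setup_Y ok)) ?HB //.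
  exact: (feas 0%N (leq0n _)).1.
- exact: ltnW.
Qed.

(** With [1 / lam = 10 * mu], a step longer than the threshold has Bregman cost at
    least [10 * eta], against a loss of at most [eta] from inexactness. *)
Lemma stop_descent xk xn : D xk -> D xn ->
  (forall x', D x' -> pen_prox_obj P lam xk pen xn <= pen_prox_obj P lam xk pen x' + eta) ->
  ~ (`|xn - xk| <= Num.sqrt (2 * eta / mu_of P lam)) ->
  pen_obj P pen xn + 9%:R * eta <= pen_obj P pen xk.
Proof.
move=> Dxk Dxn H /negP; rewrite -ltNge => far.
have Uo : dgf_interior D (omX P) xk by split=> //; exact: domX_sub_omX ok _ Dxk.
have br := breg_ge (prox_setup_X ok) Uo Dxn.
have m0 := mu_gt0.
have sq : 2 * eta / mu_of P lam < `|xn - xk| ^+ 2.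
  rewrite -(@sqr_sqrtr _ (2 * eta / mu_of P lam)); last first.
    by rewrite divr_ge0 ?mulr_ge0 ?ltW.
  by rewrite ltr_pXn2r // ?nnegrE ?sqrtr_ge0.
have b0 : breg wX xk xk = 0 by rewrite breg_expand; ring.
have := H xk Dxk; rewrite /pen_prox_obj -/wX b0 mulr0 addr0 => h.
have : 10%:R * eta <= lam^-1 * breg wX xn xk.
  rewrite lamV; move: sq; rewrite mu_ofE ltr_pdivrMr ?divr_gt0 ?(gamma_gt0 ok) // => sq.
  have g0 := gamma_gt0 ok.
  have := ler_wpM2l (ltW g0) br; rewrite -/wX.
  by move: sq; move: (`|_| ^+ 2) (breg _ _ _) (gamma P) => u v w; lra.
by move: h; move: (pen_obj _ _ _) (pen_obj _ _ _) (_ * _) => a b c; lra.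
Qed.

Section TerminatedRun.
Variables (x1 : X) (log : pd_log X Y) (K : nat).
Hypotheses (Dx1 : D x1) (run : pd_run P lam eta x1 log K).

Lemma run_spec k : (0 < k <= K)%N -> D (iter_x log k) /\ D (iter_x log k.+1) /\
  forall x', D x' -> pen_prox_obj P lam (iter_x log k) pen (iter_x log k.+1)
    <= pen_prox_obj P lam (iter_x log k) pen x' + eta.
Proof.
have [E H _] := run.
have key j : (j < K)%N -> D (iter_x log j.+1).
  elim: j => [_|j IH jK]; first by rewrite E.
  have jK' : (0 < j.+1 <= K)%N by rewrite /= ltnW.
  have [Hp Hd] := H j.+1 jK'.
  by have [] := dual_solve_spec (IH (ltnW jK)) Hp Hd.
move=> /[dup] kK /andP[k0 k1].
have Dk : D (iter_x log k) by case: k k0 k1 {kK} => // k _; exact: key.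
have [Hp Hd] := H k kK.
by split=> //; exact: dual_solve_spec Dk Hp Hd.
Qed.

Lemma run_descent k : (0 < k <= K)%N ->
  pen_obj P pen (iter_x log k) + 9%:R * eta * k.-1%:R <= pen_obj P pen x1.
Proof.
have [E _ ns] := run.
case: k => // k; rewrite /=; elim: k => [|k IH] kK; first by rewrite E mulr0 addr0.
have [Dk [Dk1 H]] := run_spec (k := k.+1) (ltnW kK).
have := stop_descent Dk Dk1 H (ns k.+1 kK); have := IH (ltnW kK).
rewrite -[k.+1%:R]natr1 mulrDr mulr1 /=.
by move: (pen_obj _ _ _) (pen_obj _ _ _) (pen_obj _ _ _) (_ * k%:R) => a b c d; lra.
Qed.

(** The constant 13 is made of twice [2 * eta] for smoothing at both ends and
    [9 * eta] for the last iteration. *)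
Lemma run_length :
  9%:R * eta * K%:R <= fine (q_obj P x1 - q_star P)%E + 13%:R * eta.
Proof.
rewrite (DeltaE ok) //.
have r0 : 0 <= rho by exact/ltW/rho_gt0.
have q1 := pen_obj_bounded_below ok Dx1.
have [K0|K0] := posnP K; first by rewrite K0 mulr0; move: q1 eta0; lra.
have KK : (0 < K <= K)%N by rewrite K0 leqnn.
have [DK _] := run_spec KK.
have h1 := run_descent KK; have q2 := pen_obj_bounded_below ok DK.
have [h2 _] := pen_obj_smooth_close ok r0 Dx1.
have [_ h3] := pen_obj_smooth_close ok r0 DK.
rewrite rho_RY in h2 h3.
have -> : K%:R = K.-1%:R + 1 :> R by rewrite natr1 prednK.
rewrite mulrDr mulr1; move: q1 h1 q2 h2 h3; rewrite -/pen.
move: (pen_obj _ _ _) (pen_obj _ _ _) (pen_obj _ _ _) (pen_obj _ _ _) (fine _).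
by move: (_ * K.-1%:R) => *; lra.
Qed.

End TerminatedRun.
End Accuracy.
End Execution.

(** * Near-stationarity and existence of runs *)

Section Correctness.
Context {R : realType} {X Y : normedModType R}.
Variable P : problem X Y.
Hypothesis ok : problem_ok P.
Hypothesis fX : finite_dimensional X.

Let D := domX P.
Let FY := feasY P.
Let lam := lam_of P.

Lemma eta_of_over_mu eps : eta_of P eps / mu_of P lam = (lam * eps / betaX P) ^+ 2 / 32%:R.
Proof.
have g0 := gamma_gt0 ok; have l0 := lam_gt0 ok; have m0 := mu_gt0 ok.
have b0 : 0 < betaX P := lt_le_trans ltr01 (betaX_ge1 ok).
rewrite /eta_of -/lam.
have -> : 1 - gamma P * lam = lam * mu_of P lam.
  by rewrite /mu_of mulrBr divff ?gt_eqF // [gamma P * _]mulrC.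
by field; rewrite !gt_eqF.
Qed.

Lemma eta_of_gt0 eps : 0 < eps -> 0 < eta_of P eps.
Proof.
move=> e0; have b0 : 0 < betaX P := lt_le_trans ltr01 (betaX_ge1 ok).
have l0 := lam_gt0 ok; have m0 := mu_gt0 ok.
have -> : eta_of P eps = eta_of P eps / mu_of P lam * mu_of P lam.
  by rewrite divfK // gt_eqF.
by rewrite eta_of_over_mu mulr_gt0 // divr_gt0 // exprn_gt0 // divr_gt0 // mulr_gt0.
Qed.

Section Accuracy.
Variable eps : R.
Hypothesis eps0 : 0 < eps.
Let eta := eta_of P eps.
Let rho := rho_of P eta.
Let pen := smooth_penalty P rho.
Let eta0 : 0 < eta := eta_of_gt0 eps0.

(** Passing between the smoothed and the exact objective costs [2 * eta] at [xn]
    and at the proximal point, and the inexact solution costs [eta]; strong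
    convexity turns these [5 * eta] into a distance. *)
Lemma near_stationary_stop xk xn : D xk -> D xn ->
  (forall x', D x' -> pen_prox_obj P lam xk pen xn <= pen_prox_obj P lam xk pen x' + eta) ->
  `|xn - xk| <= Num.sqrt (2 * eta / mu_of P lam) ->
  near_stationary P eps xk.
Proof.
move=> Dxk Dxn H stop; split=> //.
have l0 := lam_gt0 ok; have m0 := mu_gt0 ok.
have b0 : 0 < betaX P := lt_le_trans ltr01 (betaX_ge1 ok).
have r0 : 0 <= rho := ltW (rho_gt0 ok eta0).
have bb : exists b, forall x, D x -> b <= pen_obj P (gY P) x.
  by exists (fine (q_star P)) => x; exact: pen_obj_bounded_below.
have [p Dp mp] := pen_prox_obj_minimizer ok fX l0 m0 Dxk (penalty_gY ok) bb.
exists lam, p; split; first exact: lam_lt.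
  apply: (is_proxI ok) => // x Dx; apply: le_trans (mp x Dx); rewrite lerDl.
  by rewrite mulr_ge0 ?exprn_ge0 // divr_ge0 // ltW.
have [h1 _] := pen_obj_smooth_close ok r0 Dp; have [_ h2] := pen_obj_smooth_close ok r0 Dxn.
rewrite (rho_RY ok) -/pen in h1 h2.
have h3 := mp xn Dxn; have h4 := H p Dp.
(* [mu / 2] times the squared distance is at most [5 * eta] *)
have d1 : `|xn - p| ^+ 2 <= 10%:R * (eta / mu_of P lam).
  rewrite mulrA ler_pdivlMr //; move: h1 h2 h3 h4; rewrite /pen_prox_obj.
  move: (pen_obj _ _ _) (pen_obj _ _ _) (pen_obj _ _ _) (pen_obj _ _ _) (_ * breg _ _ _) (_ * breg _ _ _).
  by move: (`|_| ^+ 2) (mu_of _ _) => n m a b c d e f *; lra.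
have d2 : `|xn - xk| ^+ 2 <= 2 * (eta / mu_of P lam).
  have e0 : 0 <= 2 * eta / mu_of P lam.
    by rewrite divr_ge0 ?(ltW m0) // mulr_ge0 ?(ltW eta0).
  by rewrite mulrA -(sqr_sqrtr e0) ler_pXn2r ?nnegrE ?sqrtr_ge0.
rewrite normrZ gtr0_norm ?invr_gt0 // ler_pdivrMl //.
have tri : `|xk - p| <= `|xn - xk| + `|xn - p|.
  by rewrite [`|xn - xk|]distrC; exact: ler_distD.
(* [2 * (2 + 10) = 24] does not exceed the denominator 32 in [eta] *)
rewrite mulrA; set T := lam * eps / betaX P.
have T0 : 0 <= T by rewrite divr_ge0 ?(ltW b0) // mulr_ge0 ?(ltW l0) ?(ltW eps0).
rewrite -(@ler_pXn2r _ 2) ?nnegrE //.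
move: d1 d2; rewrite eta_of_over_mu -/T => d1 d2.
apply: (@le_trans _ _ ((`|xn - xk| + `|xn - p|) ^+ 2)).
  by rewrite ler_pXn2r // nnegrE ?addr_ge0.
have := sqr_ge0 (`|xn - xk| - `|xn - p|).
have := sqr_ge0 T.
move: d1 d2 {tri T0}; move: (`|xn - xk|) (`|xn - p|) T => a b t d1 d2 s1 s2.
move: s2; rewrite sqrrB sqrrD; move: d1 d2 s1.
by move: (a ^+ 2) (b ^+ 2) (t ^+ 2) (a * b) => *; lra.
Qed.

Lemma run_correct x1 log K : D x1 ->
  pd_run P lam eta x1 log K -> terminates P lam eta log K ->
  smoothing_framework P lam eta x1 (iter_x log) K /\
  near_stationary P eps (iter_x log K).
Proof.
move=> Dx1 run [K0 stop]; have [E _ ns] := run.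
have KK : (0 < K <= K)%N by rewrite K0 leqnn.
have [DK [DK1 HK]] := run_spec ok fX eta0 Dx1 run KK.
split; last exact: near_stationary_stop DK DK1 HK stop.
split=> // k kK; have [Dk [Dk1 Hk]] := run_spec ok fX eta0 Dx1 run kK.
split=> //; apply: (Q_smooth_approx ok) => //;
  [exact: lam_gt0|exact: (ltW (rho_gt0 ok eta0))].
Qed.

(** Iterating a choice of solved subproblems gives an infinite run; it reaches the
    stopping test because [run_length] bounds every prefix that does not. *)
Lemma run_exists x1 sx sy : D x1 ->
  (forall k i, dgf_interior D (omX P) (sx k i)) ->
  (forall k, dgf_interior FY (omY P) (sy k)) ->
  exists (log : pd_log X Y) (K : nat),
    [/\ pd_run P lam eta x1 log K, terminates P lam eta log K &
        starts_at log K sx sy].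
Proof.
move=> Dx1 Hsx Hsy.
pose step := (apg_trace Y * nat * (nat -> apg_trace X) * (nat -> nat) * X)%type.
pose spec (k : nat) (x : X) (s : step) :=
  let: (dtr, dlen, ptr, plen, xn) := s in
  [/\ forall i, (i <= dlen)%N -> primal_solve P lam (epsbar P lam eta / 2) x
        (apg_u dtr i) (plen i) (ptr i) /\ apg_u (ptr i) 0 = sx k i,
      dual_solve P lam eta x (fun i => apg_z (ptr i) (plen i)) dlen dtr xn,
      apg_u dtr 0 = sy k & D xn].
have /choice[nxt Hnxt] : forall kx : nat * X, exists s : step,
    D kx.2 -> spec kx.1 kx.2 s.
  move=> [k x] /=; have [Dx|nDx] := pselect (D x); last first.
    have t0 (T : normedModType R) : apg_trace T.
      by exact: (ApgTrace (fun=> 0) (fun=> 0) (fun=> 0) (fun=> 0)).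
    by exists (t0 Y, 0%N, fun=> t0 X, fun=> 0%N, 0).
  have [dtr [dlen [ptr [plen [xn H]]]]] :=
    dual_solve_exists ok fX eta0 Dx (Hsy k) (Hsx k).
  by exists (dtr, dlen, ptr, plen, xn).
pose xs := fix xs j := if j is j'.+1 then (nxt (j, xs j')).2 else x1.
have Dxs j : D (xs j).
  elim: j => [//|j IH] /=; have := Hnxt (j.+1, xs j) IH.
  by case: (nxt _) => [[[[a b] c] d] e] [].
pose st k := nxt (k, xs k.-1).
pose log := PdLog (fun k => xs k.-1) (fun k => (st k).1.1.1.1)
  (fun k => (st k).1.1.1.2) (fun k => (st k).1.1.2) (fun k => (st k).1.2).
have Hst k : (0 < k)%N -> [/\ forall i, (i <= dual_len log k)%N ->
      primal_solve P lam (epsbar P lam eta / 2) (iter_x log k)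
        (apg_u (dual_tr log k) i) (primal_len log k i) (primal_tr log k i)
      /\ apg_u (primal_tr log k i) 0 = sx k i,
    dual_solve P lam eta (iter_x log k) (xhat log k) (dual_len log k)
      (dual_tr log k) (iter_x log k.+1) &
    apg_u (dual_tr log k) 0 = sy k].
  case: k => // k _; have := Hnxt (k.+1, xs k) (Dxs k).
  rewrite /log /xhat /= /st /=; case: (nxt _) => [[[[a b] c] d] e] [h1 h2 h3 _].
  by split.
have runs K : (forall k, (0 < k < K)%N -> ~ stops P lam eta (iter_x log) k) ->
    pd_run P lam eta x1 log K.
  move=> ns; split=> // k /andP[k0 _]; have [h1 h2 _] := Hst k k0; split=> //.
  by move=> i ik; have [] := h1 i ik.
have [|K [[K0 stK] minK]] := @first_indexP
    (fun k => (0 < k)%N /\ stops P lam eta (iter_x log) k).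
  apply: contrapT => /forallNP none.
  pose N := (Num.truncn ((fine (q_obj P x1 - q_star P)%E + 13%:R * eta) / (9%:R * eta))).+1.
  have rN : pd_run P lam eta x1 log N.
    by apply: runs => k /andP[k0 _] sk; exact: (none k).
  have := run_length ok fX eta0 Dx1 rN.
  have e9 : 0 < 9%:R * eta by rewrite pmulr_rgt0 //; exact: eta0.
  rewrite [X in X <= _]mulrC -ler_pdivlMr // leNgt => /negP; apply.
  exact: truncnS_gt.
exists log, K; split=> //.
- apply: runs => k /andP[k0 kK] sk; exact: (minK k kK).
- move=> k /andP[k0 _]; have [h1 _ h3] := Hst k k0; split=> //.
  by move=> i ik; have [] := h1 i ik.
Qed.

End Accuracy.
End Correctness.

(** * Iteration counts *)

Section Counting.
Context {R : realType}.
Implicit Types theta a b l s : R.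

Lemma expR_half_le s : 0 <= s <= 1 -> expR (s / 2) <= 1 + s.
Proof.
move=> /andP[s0 s1].
have h : 1 - s / 2 <= expR (- (s / 2)) by have := expR_ge1Dx (- (s / 2)).
have p : 0 < 1 - s / 2 by lra.
rewrite -[s / 2]opprK expRN; apply: (@le_trans _ _ (1 - s / 2)^-1).
  by rewrite lef_pV2 ?posrE ?expR_gt0.
rewrite invf_ple ?posrE //; last by lra.
rewrite -[X in X <= _]mul1r ler_pdivrMr; last by lra.
nra.
Qed.

(** Only the last unfinished step is used, through
    [expR (sqrt theta / 2) <= 1 + sqrt theta]. *)
Lemma iteration_count theta a b l n : 0 < theta <= 1 -> 0 < a -> 0 <= l ->
  b <= a * expR l ->
  (forall t, (t < n)%N -> apg_A theta t * a < b) ->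
  n%:R <= 1 + 2 * l / Num.sqrt theta.
Proof.
move=> /andP[th0 th1] a0 l0 bl H.
have s0 : 0 < Num.sqrt theta by rewrite sqrtr_gt0.
have s1 : Num.sqrt theta <= 1 by rewrite -[X in _ <= X]sqrtr1 ler_wsqrtr.
case: n H => [|n] H; first by rewrite addr_ge0 // divr_ge0 ?mulr_ge0 // ltW.
rewrite -natr1 addrC lerD2l ler_pdivlMr //.
have := lt_le_trans (H n (ltnSn n)) bl; rewrite mulrC ltr_pM2l // apg_AE => h.
have : expR (n%:R * (Num.sqrt theta / 2)) < expR l.
  rewrite expRM_natl; apply: le_lt_trans h; apply: lerXn2r; rewrite ?nnegrE.
  - exact: expR_ge0.
  - by rewrite addr_ge0 // ltW.
  - by apply: expR_half_le; rewrite ltW.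
by rewrite ltr_expR; lra.
Qed.

Lemma expR_ln_inv (eps : R) m : 0 < eps -> expR (m%:R * ln eps^-1) = eps ^- m.
Proof. by move=> e0; rewrite expRM_natl lnK ?posrE ?invr_gt0 // exprVn. Qed.

End Counting.

Ltac pos_step := first
  [ assumption | exact: ltr01 | exact: ler01 | exact: ltr0Sn | exact: ler0n
  | (apply: ltW; assumption) | exact: sqrtr_ge0
  | apply: exprn_gt0 | apply: exprn_ge0
  | rewrite invr_gt0 | rewrite invr_ge0
  | apply: mulr_gt0 | apply: mulr_ge0 | apply: addr_gt0 | apply: addr_ge0 ].
Ltac pos := solve [repeat pos_step].

(** The counts are inequalities between real numbers, in the constants of a
    problem.  The number [kk] stands for [32 * 100] in the value of [eta]; only the
    bound [kk <= 40 * 81] matters. *)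
Section Arithmetic.
Context {R : realType}.
Variables (kk g lxx lxy lyy be ry Dl Dd eps : R).
Hypotheses (kk0 : 0 < kk) (kk1 : kk <= 3240%:R) (g0 : 0 < g)
  (glxx : g <= lxx) (lxy0 : 0 <= lxy) (lyy0 : 0 <= lyy)
  (lpos : 0 < lxy + lyy) (be1 : 1 <= be) (ry0 : 0 < ry) (Dl0 : 0 <= Dl)
  (eps0 : 0 < eps).

Let lp := lyy + lxy ^+ 2 / (g / 9%:R).
Let eta := eps ^+ 2 * 9%:R / (kk * g * be ^+ 2).
Let rho := 2 * eta / ry.
Let S := Num.sqrt (lyy * g) + lxy.
Let l := ln eps^-1.
Let sigma := Num.sqrt (2 * lp / rho).
Let L' := lxx + g * be.

(* Small [eps]: [m1] and [m5] bound the arguments of the logarithms by powers of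
   [1 / eps], [m2] makes the dual [theta] at most 1, and [m3] and [m4] absorb
   additive constants. *)
Let m1 := 2 * lp * Dd * (2 * kk * g * be ^+ 2 / 9%:R).
Let m2 := 9%:R / (kk * g * be ^+ 2 * lp * ry).
Let m3 := 2 / S.
Let m4 := 2 / g.
Let m5 := L' * Dd * (4%:R * kk * g * be ^+ 2 / 9%:R) * (1 + 60%:R * be * Num.sqrt ry * S).

Hypotheses (c0 : eps * expR 1 <= 1) (c1 : eps * m1 <= 1) (c2 : eps * m2 <= 1)
  (c3 : eps * m3 <= 1) (c4 : eps * m4 <= 1) (c5 : eps * m5 <= 1).

Let be0 : 0 < be. Proof. exact: lt_le_trans ltr01 be1. Qed.
Let lp0 : 0 < lp.
Proof.
rewrite /lp; have [y0 | y0] := ltP 0 lyy.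
  by rewrite ltr_pwDl // divr_ge0 ?exprn_ge0 // divr_ge0 // ltW.
have x0 : 0 < lxy by apply: lt_le_trans lpos _; rewrite gerDl.
by rewrite addrC ltr_pwDl // divr_gt0 ?exprn_gt0 // divr_gt0.
Qed.
Let eta0 : 0 < eta.
Proof. by apply: divr_gt0; rewrite !mulr_gt0 ?exprn_gt0. Qed.
Let rho0 : 0 < rho. Proof. exact: (divr_gt0 (mulr_gt0 (ltr0Sn _ 1) eta0) ry0). Qed.
Let S0 : 0 < S.
Proof.
rewrite /S; have [y0 | y0] := ltP 0 lyy.
  by rewrite ltr_pwDl // sqrtr_gt0 mulr_gt0.
rewrite addrC ltr_pwDl ?sqrtr_ge0 //.
by apply: lt_le_trans lpos _; rewrite gerDl.
Qed.
Let eps1 : eps <= 1.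
Proof.
apply: le_trans c0; rewrite ler_peMr ?(ltW eps0) //.
by apply: le_trans (expR_ge1Dx 1); rewrite lerDl.
Qed.
Let l1 : 1 <= l.
Proof.
rewrite -[X in X <= _](expRK 1) ler_ln ?posrE ?expR_gt0 ?invr_gt0 //.
by rewrite -[X in _ <= X]mul1r ler_pdivlMr // mulrC.
Qed.
Let L'0 : 0 < L'.
Proof. by apply: addr_gt0; [exact: lt_le_trans glxx|pos]. Qed.

(** [sigma] is [1 / sqrt theta] for the dual solver; [60 ^ 2] exceeds [kk]. *)
Lemma inv_sqrt_theta_le : sigma <= 60%:R * be * Num.sqrt ry * S / eps.
Proof.
have B0 : 0 <= 60%:R * be * Num.sqrt ry * S / eps by pos.
rewrite -(@ler_pXn2r _ 2) ?nnegrE ?sqrtr_ge0 // sqr_sqrtr; last by pos.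
have -> : 2 * lp / rho = (lyy * g + 9%:R * lxy ^+ 2) * (ry * be ^+ 2 * kk / 9%:R / eps ^+ 2).
  by rewrite /lp /rho /eta; field; rewrite !gt_eqF.
have hS : lyy * g + 9%:R * lxy ^+ 2 <= 9%:R * S ^+ 2.
  have lg : 0 <= lyy * g by rewrite mulr_ge0 ?(ltW g0).
  have := sqr_sqrtr lg; have := sqrtr_ge0 (lyy * g); rewrite /S.
  move: (Num.sqrt _) => r r0 <-.
  have := mulr_ge0 r0 lxy0; have := sqr_ge0 r; rewrite sqrrD.
  by move: (r ^+ 2) (lxy ^+ 2) (r * lxy) => *; lra.
have k0 : 0 <= ry * be ^+ 2 * kk / 9%:R / eps ^+ 2 by pos.
apply: le_trans (ler_wpM2r k0 hS) _.
have -> : (60%:R * be * Num.sqrt ry * S / eps) ^+ 2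
    = 3600%:R * (ry * be ^+ 2 * S ^+ 2 / eps ^+ 2).
  by rewrite !exprMn exprVn sqr_sqrtr ?(ltW ry0) //; ring.
have -> : 9%:R * S ^+ 2 * (ry * be ^+ 2 * kk / 9%:R / eps ^+ 2)
    = kk * (ry * be ^+ 2 * S ^+ 2 / eps ^+ 2).
  by field; rewrite gt_eqF.
apply: ler_wpM2r; last by apply: le_trans kk1 _; rewrite ler_nat.
by pos.
Qed.

Lemma dual_count n :
  (forall t, (t < n)%N -> apg_A (rho / (2 * lp)) t * (eta / 2) < 2 * lp * Dd) ->
  n.+1%:R <= (1 + 360%:R * be * Num.sqrt ry) * S * eps^-1 * l.
Proof.
move=> H; have th0 : 0 < rho / (2 * lp) by pos.
have th1 : rho / (2 * lp) <= 1.
  have -> : rho / (2 * lp) = eps * (eps * m2).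
    by rewrite /m2 /rho /eta; field; rewrite !gt_eqF.
  by apply: mulr_ile1 => //; rewrite /m2; pos.
have l0 : 0 <= 3%:R * l by apply: mulr_ge0 => //; exact: le_trans l1.
have hb : 2 * lp * Dd <= eta / 2 * expR (3%:R * l).
  rewrite expR_ln_inv //.
  have -> : eta / 2 * eps ^- 3 = (eps * (2 * kk * g * be ^+ 2 / 9%:R))^-1.
    by rewrite /eta; field; rewrite !gt_eqF.
  have k0 : 0 < eps * (2 * kk * g * be ^+ 2 / 9%:R) by pos.
  by rewrite -[X in _ <= X]mul1r ler_pdivlMr //; move: c1; rewrite /m1 mulrCA.
have := iteration_count (andb_true_intro (conj th0 th1)) (divr_gt0 eta0 (ltr0Sn _ 1)) l0 hb H.
have -> : 2 * (3%:R * l) / Num.sqrt (rho / (2 * lp)) = 6%:R * l * sigma.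
  by rewrite -sqrtrV ?(ltW th0) // invf_div /sigma; ring.
move=> hn; rewrite -natr1.
have l00 : 0 <= l by exact: le_trans l1.
have hs := ler_wpM2l l00 inv_sqrt_theta_le.
have h2 : 2 <= S * eps^-1 * l.
  apply: (@le_trans _ _ (S * eps^-1)).
    by rewrite ler_pdivlMr //; move: c3; rewrite /m3 mulrA ler_pdivrMr // mul1r mulrC.
  by rewrite ler_peMr //; pos.
move: hn hs h2.
have -> : l * (60%:R * be * Num.sqrt ry * S / eps) = 60%:R * (be * Num.sqrt ry * (S * eps^-1 * l)) by ring.
have -> : (1 + 360%:R * be * Num.sqrt ry) * S * eps^-1 * l = S * eps^-1 * l + 360%:R * (be * Num.sqrt ry * (S * eps^-1 * l)) by ring.
rewrite -[6%:R * l * sigma]mulrA.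
move: (S * eps^-1 * l) => z; move: (be * Num.sqrt ry * z) => y.
by move: (l * sigma) => x; lra.
Qed.

Lemma outer_count K :
  9%:R * eta * K%:R <= Dl + 13%:R * eta ->
  K%:R <= (1 + 40%:R * Dl * be ^+ 2) * g * eps ^- 2.
Proof.
move=> H.
have e2 : 2 <= g * eps ^- 2.
  rewrite ler_pdivlMr ?exprn_gt0 //.
  have h : 2 * eps <= g by move: c4; rewrite /m4 mulrA ler_pdivrMr // mul1r mulrC.
  by apply: le_trans h; rewrite expr2 ler_wpM2l // ler_piMl // ltW.
have h1 : K%:R <= 2 + Dl / (9%:R * eta).
  have p : 0 < 9%:R * eta by pos.
  rewrite -(ler_pM2l p) mulrDr [X in _ + X]mulrC divfK ?gt_eqF //.
  by apply: le_trans H _; move: eta0; lra.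
apply: le_trans h1 _.
have -> : (1 + 40%:R * Dl * be ^+ 2) * g * eps ^- 2
   = g * eps ^- 2 + 40%:R * (Dl * be ^+ 2 * g * eps ^- 2) by ring.
have -> : Dl / (9%:R * eta) = kk / 81%:R * (Dl * be ^+ 2 * g * eps ^- 2).
  by rewrite /eta; field; rewrite !gt_eqF.
apply: lerD => //; apply: ler_wpM2r; first by pos.
by rewrite ler_pdivrMr // -natrM; apply: le_trans kk1 _; rewrite ler_nat.
Qed.

Lemma primal_count n :
  (forall t, (t < n)%N -> apg_A (g / 9%:R / L') t * (eta / (2 * (1 + sigma)) / 2)
     < L' * Dd) ->
  n.+1%:R <= (26%:R + 24%:R * be) * Num.sqrt (lxx / g) * l.
Proof.
move=> H; have gl : 0 < lxx := lt_le_trans g0 glxx.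
have th0 : 0 < g / 9%:R / L' by pos.
have th1 : g / 9%:R / L' <= 1.
  rewrite ler_pdivrMr // mul1r /L'; have := mulr_gt0 g0 be0; move: glxx g0.
  by move: (g * be) => x; lra.
have l0 : 0 <= l by exact: le_trans l1.
have l40 : 0 <= 4%:R * l by pos.
have s0 : 0 <= sigma by exact: sqrtr_ge0.
have s1 : 0 < 1 + sigma by rewrite ltr_pwDl.
have T0 : 0 < 1 + 60%:R * be * Num.sqrt ry * S.
  by rewrite ltr_pwDl //; pos.
have a0 : 0 < eta / (2 * (1 + sigma)) / 2 by pos.
have hb : L' * Dd <= eta / (2 * (1 + sigma)) / 2 * expR (4%:R * l).
  rewrite expR_ln_inv //.
  have hs : eps * (1 + sigma) <= 1 + 60%:R * be * Num.sqrt ry * S.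
    rewrite mulrDr mulr1; apply: lerD => //.
    by rewrite mulrC -ler_pdivlMr //; exact: inv_sqrt_theta_le.
  pose k := 4%:R * kk * g * be ^+ 2 / 9%:R.
  have k0 : 0 < k by pos.
  have -> : eta / (2 * (1 + sigma)) / 2 * eps ^- 4
     = (k * eps * (eps * (1 + sigma)))^-1.
    by rewrite /eta /k; field; rewrite !gt_eqF.
  apply: (@le_trans _ _ (k * eps * (1 + 60%:R * be * Num.sqrt ry * S))^-1); last first.
    by rewrite lef_pV2 ?posrE ?mulr_gt0 // ler_wpM2l // ltW // mulr_gt0.
  rewrite -[X in _ <= X]mul1r ler_pdivlMr ?mulr_gt0 //.
  by move: c5; rewrite /m5 -/k; congr (_ <= _); ring.
have := iteration_count (andb_true_intro (conj th0 th1)) a0 l40 hb H.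
set r := Num.sqrt (lxx / g).
have r1 : 1 <= r.
  by rewrite -[X in X <= _]sqrtr1 ler_wsqrtr // ler_pdivlMr // mul1r.
have r0 : 0 <= r by exact: le_trans r1.
have hr : (Num.sqrt (g / 9%:R / L'))^-1 <= 3%:R * (1 + be) * r.
  rewrite -sqrtrV ?(ltW th0) // -(@ler_pXn2r _ 2) ?nnegrE ?sqrtr_ge0 //; last first.
    by pos.
  rewrite sqr_sqrtr ?invr_ge0 ?(ltW th0) // !exprMn sqr_sqrtr; last by pos.
  have -> : (g / 9%:R / L')^-1 = 9%:R * L' / g by field; rewrite !gt_eqF.
  have -> : 3%:R ^+ 2 * (1 + be) ^+ 2 * (lxx / g) = 9%:R * ((1 + be) ^+ 2 * lxx) / g.
    by field; rewrite !gt_eqF.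
  rewrite ler_pM2r ?invr_gt0 // ler_pM2l // /L'.
  apply: (@le_trans _ _ ((1 + be) * lxx)).
    by rewrite mulrDl mul1r lerD2l mulrC ler_wpM2l // ltW.
  apply: ler_wpM2r; first exact: ltW.
  by rewrite expr2 ler_peMr ?addr_ge0 ?(ltW be0) // lerDl ltW.
have hl := ler_wpM2l l0 hr.
have rl : 1 <= r * l by rewrite mulr_ege1.
move=> hn; rewrite -natr1; move: hn hl rl; rewrite -!mulrA.
have -> : l * (3%:R * ((1 + be) * r)) = 3%:R * (r * l) + 3%:R * (be * (r * l)) by ring.
have -> : (26%:R + 24%:R * be) * (r * l) = 26%:R * (r * l) + 24%:R * (be * (r * l)) by ring.
by move: (l / _) (r * l) (be * _) => x y z; lra.
Qed.

End Arithmetic.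

(** * Complexity bounds *)

(** The product of the constants in [outer_count], [dual_count] and
    [primal_count]. *)
Definition bound_const (R : realType) (be Dl rY D : R) : R :=
  (1 + 40%:R * Dl * be ^+ 2) * (1 + 360%:R * be * Num.sqrt rY)
  * (26%:R + 24%:R * be).

(** Below this threshold [eps] times [expR 1] and times each [`|m|] is at most 1;
    the first makes [ln (1 / eps)] at least 1, and the [m] are those of the
    iteration counts. *)
Definition eps_threshold (R : realType) (c : constants R) (Dl rY D : R) : R :=
  let kk := 32%:R * 100%:R in
  let lp := Lyy c + Lxy c ^+ 2 / (gamma c / 9%:R) in
  let S := Num.sqrt (Lyy c * gamma c) + Lxy c in
  let L' := Lxx c + gamma c * betaX c in
  let m1 := 2 * lp * D * (2 * kk * gamma c * betaX c ^+ 2 / 9%:R) in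
  let m2 := 9%:R / (kk * gamma c * betaX c ^+ 2 * lp * rY) in
  let m3 := 2 / S in
  let m4 := 2 / gamma c in
  let m5 := L' * D * (4%:R * kk * gamma c * betaX c ^+ 2 / 9%:R)
              * (1 + 60%:R * betaX c * Num.sqrt rY * S) in
  (expR 1 + (`|m1| + `|m2| + `|m3| + `|m4| + `|m5|))^-1.

Lemma threshold_gt0 (R : realType) (c : constants R) (Dl rY D : R) :
  0 < eps_threshold c Dl rY D.
Proof. by rewrite invr_gt0 ltr_pwDl ?expR_gt0 // !addr_ge0. Qed.

Section Complexity.
Context {R : realType} {X Y : normedModType R}.
Variable P : problem X Y.
Hypothesis ok : problem_ok P.
Hypothesis fX : finite_dimensional X.
Let lam := lam_of P.

Lemma eta_of_explicit eps : eta_of P eps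
  = eps ^+ 2 * 9%:R / (32%:R * 100%:R * gamma P * betaX P ^+ 2).
Proof.
have g0 := gamma_gt0 ok; have b0 := lt_le_trans ltr01 (betaX_ge1 ok).
by rewrite /eta_of /lam_of; field; rewrite !gt_eqF.
Qed.

Lemma sum_natr_le m n (F : nat -> nat) (c : R) :
  (forall k, (m <= k < n)%N -> (F k)%:R <= c) ->
  (\sum_(m <= k < n) F k)%N%:R <= (n - m)%:R * c.
Proof.
move=> H; rewrite natr_sum -mulr_natl mulr1 mulr_natl -sumr_const_nat.
exact: ler_sum_nat.
Qed.

Lemma complexity_bounds x1 D eps log K : domX P x1 ->
  let Delta := fine (q_obj P x1 - q_star P)%E in
  0 < eps < eps_threshold P Delta (RY P) D ->
  pd_run P lam (eta_of P eps) x1 log K ->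
  starts_within P lam D log K ->
  (primal_complexity log K)%:R
    <= bound_const (betaX P) Delta (RY P) D *
       (Num.sqrt (gamma P * Lxx P)
        * (Num.sqrt (Lyy P * gamma P) + Lxy P)
        * eps ^- 3 * (ln eps^-1) ^+ 2) /\
  (dual_complexity log K)%:R
    <= bound_const (betaX P) Delta (RY P) D *
       (gamma P * (Num.sqrt (Lyy P * gamma P) + Lxy P)
        * eps ^- 3 * ln eps^-1).
Proof.
move=> Dx1 Delta /andP[e0 eth] run starts.
have g0 := gamma_gt0 ok; have be1 := betaX_ge1 ok.
have ry0 := RY_pos ok; have glxx := gamma_le ok.
have eta0 := eta_of_gt0 ok e0.
have Dl0 : 0 <= Delta by rewrite /Delta (DeltaE ok) // subr_ge0 pen_obj_bounded_below.
move: eth; rewrite /eps_threshold.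
set kk := 32%:R * 100%:R.
set lp := Lyy P + _; set S := Num.sqrt (Lyy P * _) + _; set L' := Lxx P + _.
set m1 := 2 * lp * _ * _; set m2 := 9%:R / _; set m3 := 2 / S.
set m4 := 2 / gamma P; set m5 := L' * _ * _ * _ => eth.
have esum : eps * (expR 1 + (`|m1| + `|m2| + `|m3| + `|m4| + `|m5|)) <= 1.
  rewrite -ler_pdivlMr ?mul1r; first exact: ltW.
  by rewrite ltr_pwDl ?expR_gt0 // !addr_ge0.
have small m : m <= expR 1 + (`|m1| + `|m2| + `|m3| + `|m4| + `|m5|) -> eps * m <= 1.
  by move=> hm; apply: le_trans esum; rewrite ler_pM2l.
have ee := expR_gt0 (1 : R).
have c0 : eps * expR 1 <= 1 by apply: small; rewrite lerDl !addr_ge0.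
have cm : [/\ eps * m1 <= 1, eps * m2 <= 1, eps * m3 <= 1, eps * m4 <= 1 & eps * m5 <= 1].
  have := ler_norm m1; have := ler_norm m2; have := ler_norm m3.
  have := ler_norm m4; have := ler_norm m5.
  move: (normr_ge0 m1) (normr_ge0 m2) (normr_ge0 m3) (normr_ge0 m4) (normr_ge0 m5).
  move: small ee; clearbody m1 m2 m3 m4 m5.
  move: (`|m1|) (`|m2|) (`|m3|) (`|m4|) (`|m5|) (expR 1) => a b c d e f small f0 *.
  by split; apply: small; lra.
case: cm => c1 c2 c3 c4 c5.
have kk0 : 0 < kk by apply: mulr_gt0; exact: ltr0Sn.
have kk1 : kk <= 3240%:R by rewrite /kk -natrM ler_nat.
have lpE : Lpi P lam = lp by rewrite /Lpi mu_ofE.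
have etaE := eta_of_explicit eps; rewrite -/kk in etaE.
set l := ln eps^-1; pose Nd := (1 + 360%:R * betaX P * Num.sqrt (RY P)) * S * eps^-1 * l.
pose Tp := (26%:R + 24%:R * betaX P) * Num.sqrt (Lxx P / gamma P) * l.
have HK : K%:R <= (1 + 40%:R * Delta * betaX P ^+ 2) * gamma P * eps ^- 2.
  apply: (outer_count kk0 kk1 g0 be1 Dl0 e0 c0 c4).
  rewrite -etaE; exact: (run_length ok fX eta0 Dx1 run).
have [E Hrun _] := run.
have HD k : (0 < k <= K)%N -> domX P (iter_x log k).
  by move=> kK; have [] := run_spec ok fX eta0 Dx1 run kK.
have HN k : (0 < k <= K)%N -> (dual_len log k).+1%:R <= Nd.
  move=> kK; have [Hp Hd] := Hrun k kK.
  apply: (dual_count kk0 kk1 g0 (Lxy_ge0 ok) (Lyy_ge0 ok) (Lxy_Lyy_gt0 ok)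
    be1 ry0 e0 c0 c1 c2 c3).
  move=> t tn.
  have := dual_solve_unfinished ok fX eta0 (HD k kK) Hp Hd (starts k kK).1 tn.
  by rewrite lpE etaE /rho_of.
have HT k i : (0 < k <= K)%N -> (i <= dual_len log k)%N ->
    (primal_len log k i).+1%:R <= Tp.
  move=> kK ik; have [Hp Hd] := Hrun k kK.
  apply: (primal_count kk0 kk1 g0 glxx (Lxy_ge0 ok) (Lyy_ge0 ok) (Lxy_Lyy_gt0 ok)
    be1 ry0 e0 c0 c5).
  move=> t tn.
  have [apg _ _] := Hd.
  have [Fu _] := apg_feasible (prox_setup_Y ok) apg ik.
  have acc0 := divr_gt0 (epsbar_gt0 P eta0) (ltr0Sn R 1).
  have := primal_solve_unfinished ok fX (mu_gt0 ok) (HD k kK) Fu acc0 (Hp i ik)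
    ((starts k kK).2 i ik) tn.
  by rewrite /epsbar lpE etaE /rho_of mu_ofE.
have hdual : (dual_complexity log K)%:R <= K%:R * Nd.
  have := @sum_natr_le 1 K.+1 (fun k => (dual_len log k).+1) Nd; rewrite subn1; apply.
  by move=> k kK; apply: HN.
have hprimal : (primal_complexity log K)%:R <= K%:R * (Nd * Tp).
  have := @sum_natr_le 1 K.+1 (fun k =>
    (\sum_(0 <= i < (dual_len log k).+1) (primal_len log k i).+1)%N) (Nd * Tp).
  rewrite subn1; apply => k kK.
  have Tp0 : 0 <= Tp by apply: le_trans (HT k 0%N kK (leq0n _)); rewrite ler0n.
  apply: le_trans (ler_wpM2r Tp0 (HN k kK)).
  have := @sum_natr_le 0 (dual_len log k).+1 (fun i => (primal_len log k i).+1) Tp.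
  by rewrite subn0; apply => i /andP[_ ik]; apply: HT.
have be0 : 0 < betaX P := lt_le_trans ltr01 be1.
have l0 : 0 <= l.
  rewrite ln_ge0 // invf_ge1 //; apply: le_trans c0.
  rewrite ler_peMr ?(ltW e0) //; apply: le_trans (expR_ge1Dx 1).
  by rewrite lerDl.
have S0 : 0 <= S by rewrite addr_ge0 ?sqrtr_ge0 // (Lxy_ge0 ok).
have lxx0 : 0 < Lxx P := lt_le_trans g0 glxx.
have Nd0 : 0 <= Nd by rewrite /Nd; clear -be0 e0 l0 S0; pos.
have Tp0 : 0 <= Tp by rewrite /Tp; clear -be0 l0; pos.
have em3 : eps ^- 3 = eps ^- 2 * eps^-1 by rewrite -invfM -exprSr.
have sE : Num.sqrt (gamma P * Lxx P) = gamma P * Num.sqrt (Lxx P / gamma P).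
  have -> : gamma P * Lxx P = gamma P ^+ 2 * (Lxx P / gamma P).
    by field; rewrite gt_eqF.
  by rewrite sqrtrM ?sqr_ge0 // sqrtr_sqr gtr0_norm.
split.
  apply: le_trans hprimal _; apply: le_trans (ler_wpM2r (mulr_ge0 Nd0 Tp0) HK) _.
  rewrite le_eqVlt; apply/orP; left; apply/eqP.
  by rewrite em3 sE /bound_const /Nd /Tp; ring.
apply: le_trans hdual _; apply: le_trans (ler_wpM2r Nd0 HK) _.
set Kb := _ * eps ^- 2 in HK *.
have -> : bound_const (betaX P) Delta (RY P) D * (gamma P * S * eps ^- 3 * l)
    = Kb * Nd * (26%:R + 24%:R * betaX P).
  by rewrite em3 /bound_const /Nd /Kb; ring.
rewrite ler_peMr //; first by rewrite mulr_ge0 // (le_trans _ HK) ?ler0n.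
apply: (@le_trans _ _ 26%:R); first by rewrite ler1n.
by rewrite lerDl mulr_ge0 // ltW.
Qed.

End Complexity.

(* C is the constant of the O-bounds: it depends only on betaX, q(x1) - q_star,
   R_Y and the bound D on the Bregman distances from the starting points.  The
   threshold e0 below which the bounds hold also depends on the constants of
   the problem, which absorbs those appearing inside the logarithms. *)
Theorem corollary4p2 (R : realType) :
  exists (C : R -> R -> R -> R -> R) (e0 : constants R -> R -> R -> R -> R),
  (forall c Delta rY D, 0 < e0 c Delta rY D) /\
  forall (X Y : normedModType R) (P : problem X Y),
  finite_dimensional X -> finite_dimensional Y -> problem_ok P ->
  forall x1 : X, domX P x1 ->
  (forall eps : R, 0 < eps ->
     let lam := lam_of P in
     let eta := eta_of P eps in
     (forall (sx : nat -> nat -> X) (sy : nat -> Y),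
        (forall k i, dgf_interior (domX P) (omX P) (sx k i)) ->
        (forall k, dgf_interior (feasY P) (omY P) (sy k)) ->
        exists (log : pd_log X Y) (K : nat),
          [/\ pd_run P lam eta x1 log K, terminates P lam eta log K &
              starts_at log K sx sy]) /\
     (forall (log : pd_log X Y) (K : nat),
        pd_run P lam eta x1 log K -> terminates P lam eta log K ->
        smoothing_framework P lam eta x1 (iter_x log) K /\
        near_stationary P eps (iter_x log K))) /\
  (let Delta := fine (q_obj P x1 - q_star P)%E in
   forall D eps : R, 0 < eps < e0 P Delta (RY P) D ->
     let lam := lam_of P in
     let eta := eta_of P eps in
     forall (log : pd_log X Y) (K : nat),
       pd_run P lam eta x1 log K -> starts_within P lam D log K ->
       (primal_complexity log K)%:R
         <= C (betaX P) Delta (RY P) D *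
            (Num.sqrt (gamma P * Lxx P)
             * (Num.sqrt (Lyy P * gamma P) + Lxy P)
             * eps ^- 3 * (ln eps^-1) ^+ 2) /\
       (dual_complexity log K)%:R
         <= C (betaX P) Delta (RY P) D *
            (gamma P * (Num.sqrt (Lyy P * gamma P) + Lxy P)
             * eps ^- 3 * ln eps^-1)).
Proof.
exists (@bound_const R), (@eps_threshold R); split; first exact: threshold_gt0.
move=> X Y P fX _ ok x1 Dx1; split.
  move=> eps eps0 lam eta; split.
    by move=> sx sy Hsx Hsy; apply: run_exists.
  by move=> log K; apply: run_correct.
move=> Delta D eps He lam eta log K run starts.
exact: complexity_bounds.
Qed.
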